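(* Let $d\ge 1$, $S=\mathbb{Z}^d$, and let $q$ be a nonnegative rate function on the finite permutations of $S$, with $\Sigma=\{\sigma : q(\sigma)>0\}$. Assume: (1) $q$ is shift invariant; (2) $\sup_{x\in S}\sum_{\sigma\in\Sigma:\, x\in Range(\sigma)} q(\sigma)<\infty$; (3) (irreducibility) for all $x,y\in S$ there are $\sigma_1,\dots,\sigma_k\in\Sigma$ with $\sigma_k\circ\cdots\circ\sigma_1(x)=y$; (4) $\sup_{\sigma\in\Sigma}|Range(\sigma)|<\infty$; (5) if $\sigma_1\in\Sigma$ and $\sigma_2$ is a finite permutation of $S$ with $Range(\sigma_2)=Range(\sigma_1)$, then $\sigma_2\in\Sigma$, and moreover $\sup\{ q(\sigma_1)/q(\sigma_2) : \sigma_1,\sigma_2\in\Sigma,\ Range(\sigma_1)=Range(\sigma_2)\}<\infty$. Let $\mathcal{I}$ be the set of stationary distributions of the permutation process on $\{0,1\}^S$ with rates $q$, let $\mathcal{S}$ be the set of shift invariant probability measures on $\{0,1\}^S$, and let $(\mathcal{I}\cap\mathcal{S})_e$ be the set of extreme points of the convex set $\mathcal{I}\cap\mathcal{S}$. Then $$(\mathcal{I}\cap\mathcal{S})_e=\{\nu_\rho : 0\le\rho\le1\},$$ where $\nu_\rho$ is the homogeneous product measure on $\{0,1\}^S$ with marginal probability $\rho$, i.e. $\nu_\rho\{\eta:\eta=1\text{ on }A\}=\rho^{|A|}$ for every finite $A\subset S$.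
   Context: A finite permutation of $S$ is a bijection $\sigma:S\to S$ such that $Range(\sigma):=\{x\in S:\sigma(x)\ne x\}$ is finite (note that $Range(\sigma)$ denotes the set of moved points). Shift invariance of $q$ means that $q(\sigma)=q(\theta_y\circ\sigma\circ\theta_y^{-1})$ for all $y\in\mathbb{Z}^d$ and all finite permutations $\sigma$, where $\theta_y(x)=x+y$. For $\eta\in\{0,1\}^S$, put $\sigma(\eta)(x):=\eta(\sigma^{-1}(x))$ for $x\in S$. The permutation process with rates $q$ is the Feller process $\eta_t$ on $\{0,1\}^S$ (product topology) in which $\eta\to\sigma(\eta)$ at rate $q(\sigma)$ for each $\sigma\in\Sigma$; that is, its generator is the closure of the operator given on functions $f:\{0,1\}^S\to\mathbb{R}$ depending on finitely many coordinates by $$\Omega f(\eta)=\sum_{\sigma\in\Sigma}q(\sigma)\,[f(\sigma(\eta))-f(\eta)].$$ Assumption (2) guarantees that this process is well defined. A probability measure $\mu$ on $\{0,1\}^S$ is stationary if $\mu S_t=\mu$ for all $t\ge0$, where $S_t$ is the semigroup of the process. No symmetry assumption $q(\sigma)=q(\sigma^{-1})$ is made. *)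

(* Defs.v *)
From HB Require Import structures.
From mathcomp Require Import all_boot all_order all_algebra.
From mathcomp Require Import finmap.
From mathcomp Require Import all_classical all_reals all_analysis.

Set Implicit Arguments.
Unset Strict Implicit.
Unset Printing Implicit Defensive.
Import Order.TTheory GRing.Theory Num.Theory.
Import numFieldNormedType.Exports.

Local Open Scope classical_set_scope.
Local Open Scope ring_scope.

Notation site d := 'rV[int]_d.

(* The inverse is stored because it occurs in the action on configurations;
   it is determined by the permutation, see [finperm_ext]. *)
Record finperm (d : nat) := FinPerm {
  fperm :> site d -> site d;
  fperm_inv : site d -> site d;
  fpermK : cancel fperm fperm_inv;
  fperm_invK : cancel fperm_inv fperm;
  fperm_finite : finite_set [set x | fperm x != x]
}.

HB.instance Definition _ (d : nat) := gen_eqMixin (finperm d).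
HB.instance Definition _ (d : nat) := gen_choiceMixin (finperm d).

Lemma finperm_ext (d : nat) (s t : finperm d) : s =1 t -> s = t.
Proof.
case: s t => [f fi fK fiK ff] [g gi gK giK gf] /= /funext fg; subst g.
have E : fi = gi by apply: funext => x; rewrite -{1}(giK x) fK.
by subst gi; congr FinPerm; exact: Prop_irrelevance.
Qed.

(* The set of moved points, written Range(sigma) in the literature. *)
Definition moved (d : nat) (s : finperm d) : set (site d) :=
  [set x | s x != x].

Section conjugation.
Variables (d : nat) (y : site d) (s : finperm d).

Let f (x : site d) := s (x - y) + y.
Let fi (x : site d) := fperm_inv s (x - y) + y.

Fact conj_shift_subproof1 : cancel f fi.
Proof. by move=> x; rewrite /f /fi addrK fpermK subrK. Qed.

Fact conj_shift_subproof2 : cancel fi f.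
Proof. by move=> x; rewrite /f /fi addrK fperm_invK subrK. Qed.

Fact conj_shift_subproof3 : finite_set [set x | f x != x].
Proof.
apply: (sub_finite_set _ (finite_image (fun x => x + y) (fperm_finite s))).
move=> x /= fx; exists (x - y); last by rewrite subrK.
by apply: contra fx => /eqP sx; rewrite /f sx subrK.
Qed.

(* theta_y \o s \o theta_y^-1, where theta_y x = x + y *)
Definition conj_shift : finperm d :=
  FinPerm conj_shift_subproof1 conj_shift_subproof2 conj_shift_subproof3.

End conjugation.

Definition config (d : nat) : Type := prod_topology (fun _ : site d => bool).

HB.instance Definition _ (d : nat) := Pointed.on (config d).
HB.instance Definition _ (d : nat) := Topological.on (config d).
HB.instance Definition _ (d : nat) := Uniform.on (config d).

(* [config d] with its Borel sigma-algebra *)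
Notation bconfig d := (g_sigma_algebraType (@open (config d))).

Definition act (d : nat) (s : finperm d) (eta : config d) : config d :=
  fun x => eta (fperm_inv s x).

Definition shift_config (d : nat) (y : site d) (eta : config d) : config d :=
  fun x => eta (x - y).

Section rates.
Variables (R : realType) (d : nat) (q : finperm d -> R).

Definition active : set (finperm d) := [set s | 0 < q s].

Definition shift_invariant_rates : Prop :=
  forall (y : site d) (s : finperm d), q s = q (conj_shift y s).

Definition bounded_total_rates : Prop :=
  (ereal_sup [set \esum_(s in active `&` [set s | moved s x]) (q s)%:E
             | x in [set: site d]] < +oo)%E.

(* [foldl] applies the head of the list first; the empty list only matters
   for [x = y]. *)
Definition irreducible_rates : Prop :=
  forall x y : site d, exists ss : seq (finperm d),
    (forall s, s \in ss -> active s) /\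
    foldl (fun z (s : finperm d) => s z) x ss = y.

Definition bounded_range : Prop :=
  (ereal_sup [set (#|` fset_set (moved s)|%:R : R)%:E | s in active]
     < +oo)%E.

Definition range_closed : Prop :=
  forall s1 s2 : finperm d, active s1 -> moved s2 = moved s1 -> active s2.

Definition bounded_ratios : Prop :=
  (ereal_sup [set (q s.1 / q s.2)%:E
             | s in [set s : finperm d * finperm d |
                 [/\ active s.1, active s.2 & moved s.1 = moved s.2]]]
     < +oo)%E.

Definition local (f : config d -> R) : Prop :=
  exists A : {fset site d}, forall eta zeta : config d,
    (forall x, x \in A -> eta x = zeta x) -> f eta = f zeta.

(* [esum] is meant for nonnegative terms, so an absolutely convergent sum is
   the difference of the sums of the positive and negative parts. *)
Definition rsum (T : choiceType) (D : set T) (a : T -> R) : R :=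
  fine (esum D (EFin \o a)^\+ - esum D (EFin \o a)^\-)%E.

Definition pregenerator (f : config d -> R) (eta : config d) : R :=
  rsum active (fun s => q s * (f (act s eta) - f eta)).

Definition closed_pregenerator (f g : config d -> R) : Prop :=
  exists u : nat -> config d -> R,
    [/\ forall n, local (u n),
        {uniform, u n @[n --> \oo] --> f} &
        {uniform, pregenerator (u n) @[n --> \oo] --> g}].

End rates.

Section semigroup.
Variables (R : realType) (d : nat).

(* Only the values [T t f] with [0 <= t] and [f] continuous are relevant. *)
Record feller_semigroup (T : R -> (config d -> R) -> config d -> R) : Prop := {
  fs_continuous : forall (t : R) (f : config d -> R),
    0 <= t -> continuous f -> continuous (T t f);
  fs_linear : forall (t a : R) (f g : config d -> R),
    0 <= t -> continuous f -> continuous g ->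
    T t (fun eta => a * f eta + g eta)
    = (fun eta => a * T t f eta + T t g eta);
  fs_ge0 : forall (t : R) (f : config d -> R),
    0 <= t -> continuous f -> (forall eta, 0 <= f eta) ->
    forall eta, 0 <= T t f eta;
  fs_one : forall t : R, 0 <= t -> T t (fun=> 1) = (fun=> 1);
  fs_id : forall f : config d -> R, continuous f -> T 0 f = f;
  fs_add : forall (s t : R) (f : config d -> R),
    0 <= s -> 0 <= t -> continuous f -> T (s + t) f = T s (T t f);
  fs_strong : forall f : config d -> R,
    continuous f -> {uniform, T t f @[t --> 0^'+] --> f}
}.

Definition generator (T : R -> (config d -> R) -> config d -> R)
    (f g : config d -> R) : Prop :=
  [/\ continuous f, continuous g &
      {uniform, (fun eta => t^-1 * (T t f eta - f eta)) @[t --> 0^'+] --> g}].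

Definition permutation_semigroup (q : finperm d -> R)
    (T : R -> (config d -> R) -> config d -> R) : Prop :=
  feller_semigroup T /\
  forall f g, generator T f g <-> closed_pregenerator q f g.

Definition stationary (T : R -> (config d -> R) -> config d -> R) :
    set (probability (bconfig d) R) :=
  [set mu : probability (bconfig d) R | forall (t : R) (f : config d -> R), 0 <= t -> continuous f ->
    (\int[mu]_eta (T t f eta)%:E = \int[mu]_eta (f eta)%:E)%E].

Definition shift_invariant : set (probability (bconfig d) R) :=
  [set mu : probability (bconfig d) R | forall (y : site d) (A : set (bconfig d)), measurable A ->
    mu (shift_config y @^-1` A) = mu A].

(* Measures are functions on all subsets, so equality of measures has to be
   restricted to measurable sets. *)
Definition extreme_points (K : set (probability (bconfig d) R)) :
    set (probability (bconfig d) R) :=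
  [set mu : probability (bconfig d) R | K mu /\
    forall (mu1 mu2 : probability (bconfig d) R) (p : R),
      K mu1 -> K mu2 -> 0 < p < 1 ->
      (forall A, measurable A ->
         mu A = (p%:E * mu1 A + (1 - p)%:E * mu2 A)%E) ->
      forall A, measurable A -> mu1 A = mu2 A].

Definition homogeneous_product (rho : R) (nu : probability (bconfig d) R) :
    Prop :=
  forall A : {fset site d},
    nu [set eta | forall x, x \in A -> eta x = true] = (rho ^+ #|` A|)%:E.

End semigroup.

(* Main.v *)
Require Import Defs.
From HB Require Import structures.
From mathcomp Require Import all_boot all_order all_algebra.
From mathcomp Require Import finmap.
From mathcomp Require Import all_classical all_reals all_analysis.
From mathcomp Require Import lra ring zify.
Import Order.TTheory GRing.Theory Num.Theory.
Import numFieldNormedType.Exports.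
Local Open Scope classical_set_scope.
Local Open Scope ring_scope.
Set Implicit Arguments.
Unset Strict Implicit.
Unset Printing Implicit Defensive.

(* Let mu be stationary and shift invariant, and let f be minus the logarithm
   of the mu-probability of the pattern seen in a finite box L, so that the
   generator applied to f has mu-mean zero. A permutation with support inside L
   contributes its rate times a relative entropy, which is nonnegative and
   controls how far mu is from being invariant under it. A permutation crossing
   the boundary of L contributes at least - 2 ^ K times its rate, K bounding the
   number of moved points. By shift invariance the total rate of the crossing
   permutations is o(|L|), while every active permutation has about |L|
   translates inside L; hence mu is invariant under all active permutations.
   Since every cyclic permutation of the support of an active permutation is
   active, irreducibility makes mu exchangeable. An exchangeable mu is the
   mixture of its conditional laws given the value at the origin, seen through
   an injection of the lattice into the complement of the origin; these are
   exchangeable too, so for an extreme mu they coincide and mu is a product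
   measure. Conversely product measures are exchangeable, hence stationary and
   shift invariant, and extreme by a second moment (ergodicity) argument. *)

(** * Configurations *)

Section configurations.
Context {d : nat}.
Implicit Types (A : {fset site d}) (eta zeta : config d).

Definition cylinder A eta : set (config d) :=
  [set zeta | forall x, x \in A -> zeta x = eta x].

Lemma nbhs_cylinder A eta : nbhs eta (cylinder A eta).
Proof.
suff H (s : seq (site d)) :
    nbhs eta [set zeta : config d | forall x, x \in s -> zeta x = eta x].
  exact: H.
elim: s => [|x s IHs]; first by apply: filterS filterT.
have Hx : nbhs eta [set zeta : config d | zeta x = eta x].
  have := @proj_continuous (site d) (fun=> bool) x eta.
  by move=> /(_ [set eta x]); apply; exact: discrete_set1.
apply: filterS (filterI Hx IHs) => zeta [/= zx zs] y.
by rewrite inE => /orP[/eqP->//|/zs].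
Qed.

(** The product topology is the supremum of the topologies pulled back by the coordinates, so it
    suffices that the filter generated by the cylinders refines each of these. A one-site window
    does this. *)
Lemma cylinder_sub_nbhs eta (U : set (config d)) :
  nbhs eta U -> exists A, cylinder A eta `<=` U.
Proof.
pose F := [set V : set (config d) | exists A, cylinder A eta `<=` V].
have FF : Filter F.
  split.
  - by exists fset0.
  - move=> V W [A AV] [B BW]; exists (A `|` B)%fset => z zAB; split.
      by apply: AV => x xA; apply: zAB; rewrite in_fsetU xA.
    by apply: BW => x xB; apply: zAB; rewrite in_fsetU xB orbT.
  - by move=> V W VW [A AV]; exists A => z /AV /VW.
suff Fc : cvg_to F (nbhs eta) by move=> /Fc.
apply/cvg_sup => x V [W [[D oD <-] Dx] WV].
exists [fset x]%fset => z zx; apply: WV => /=.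
by rewrite zx// in_fset1.
Qed.

Lemma open_cylinder_stable A (U : set (config d)) :
  (forall eta zeta, (forall x, x \in A -> eta x = zeta x) -> U eta -> U zeta) ->
  open U.
Proof.
move=> UA; rewrite openE => eta Ueta; apply: filterS (nbhs_cylinder A eta).
by move=> zeta zA; apply: UA Ueta => x /zA.
Qed.

Lemma config_compact : compact [set: config d].
Proof.
have := @tychonoff (site d) (fun=> bool) _ (fun=> bool_compact).
by congr (compact _); rewrite eqEsubset.
Qed.

Context {R : realType}.
Implicit Types f : config d -> R.

Lemma local_continuous f : local f -> continuous f.
Proof.
move=> [A fA] eta U fU; apply: filterS (nbhs_cylinder A eta) => zeta zA /=.
by rewrite (fA zeta eta zA); exact: nbhs_singleton.
Qed.

(** Uniform continuity by compactness: finitely many cylinders on which [f] stays within e / 2 of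
    its central value cover the space, and the union of their windows serves as [A]. *)
Lemma continuous_nearly_local f e : continuous f -> 0 < e ->
  exists A, forall eta zeta, (forall x, x \in A -> eta x = zeta x) ->
    `|f eta - f zeta| < e.
Proof.
move=> cf e0.
have e20 : 0 < e / 2 by rewrite divr_gt0.
pose B eta A := forall zeta, cylinder A eta zeta -> `|f eta - f zeta| < e / 2.
have exB eta : exists A, B eta A.
  have /cvgrPdist_lt /(_ _ e20) := cf eta.
  by move=> /cylinder_sub_nbhs[A AB]; exists A => zeta /AB.
have [C CB] := choice exB.
have := config_compact; rewrite compact_cover.
move=> /(_ _ [set: config d] (fun eta => cylinder (C eta) eta)).
case.
- move=> eta _; apply: (@open_cylinder_stable (C eta)) => z w zw zA x xA.
  by rewrite -zw// zA.
- by move=> eta _; exists eta.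
move=> D _ Dcov; exists (\bigcup_(eta <- D) C eta)%fset => eta zeta ez.
have [w /= wD we] := Dcov eta Logic.I.
have wz : cylinder (C w) w zeta.
  move=> x xw; rewrite -we// ez//.
  by apply/bigfcupP; exists w => //; rewrite wD.
rewrite (splitr e) -(subrKA (f w)) (le_lt_trans (ler_normD _ _))// ltrD//.
  by rewrite distrC; exact: CB we.
exact: CB wz.
Qed.

Lemma continuous_local_approx f e : continuous f -> 0 < e ->
  exists2 g, local g & forall eta, `|f eta - g eta| <= e.
Proof.
move=> cf e0; have [A fA] := continuous_nearly_local cf e0.
(* The approximation evaluates [f] after emptying all sites outside [A]. *)
exists (fun eta => f (fun x => (x \in A) && eta x)).
  exists A => eta zeta ez; congr f; apply: funext => x.
  by case: (boolP (x \in A)) => //= /ez.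
by move=> eta; apply/ltW/fA => x ->.
Qed.

(** Up to an error 1, [f] takes only the finitely many values [f (Z B)] with [B] a subset of [A];
    summing their absolute values avoids taking a maximum. *)
Lemma continuous_bounded f : continuous f ->
  exists2 M, 0 <= M & forall eta, `|f eta| <= M.
Proof.
move=> cf; have [A fA] := continuous_nearly_local cf ltr01.
pose Z (B : {fset site d}) : config d := fun x => x \in B.
exists (\sum_(B <- fpowerset A) (`|f (Z B)| + 1)).
  by apply: sumr_ge0 => B _; rewrite addr_ge0.
move=> eta; pose B := [fset x in A | eta x]%fset.
have BA : B \in fpowerset A by rewrite fpowersetE fset_sub.
rewrite (big_fsetD1 B)//=; apply: (@le_trans _ _ (`|f (Z B)| + 1)).
  rewrite -lerBlDl; apply: le_trans (lerB_dist _ _) _; apply/ltW/fA => x xA.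
  by rewrite /Z !inE xA.
by rewrite lerDl sumr_ge0// => ? _; rewrite addr_ge0.
Qed.

Lemma uniform_cvgP {T : Type} (F : set_system T) (u : T -> config d -> R) f :
  Filter F ->
  {uniform, u t @[t --> F] --> f} <->
  forall e, 0 < e -> \forall t \near F, forall eta, `|f eta - u t eta| < e.
Proof.
move=> FF; split=> [uf e e0|uf P /uniform_nbhs[E [entE EP]]].
  have := uf [set h : config d -> R | forall eta, `|f eta - h eta| < e].
  apply; apply/uniform_nbhs.
  exists [set xy : R * R | `|xy.1 - xy.2| < e]; split; first last.
    by move=> h hE eta; apply: hE.
  exact: entourage_ball (PosNum e0).
have [e /= e0 eE] : exists2 e : R, 0 < e &
    [set xy : R * R | `|xy.1 - xy.2| < e] `<=` E.
  by move: entE; rewrite -entourage_ballE => -[e /= e0 eE]; exists e.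
apply: filterS (uf e e0) => t ut; apply: EP => eta _.
exact/eE/ut.
Qed.

End configurations.

(** * Expectations of continuous functions *)

Lemma continuous_sum {R : realType} {U : topologicalType} (I : Type)
    (r : seq I) (F : I -> U -> R) : (forall i, continuous (F i)) ->
  continuous (fun x => \sum_(i <- r) F i x).
Proof.
move=> cF; elim: r => [|i r IHr] x.
  by under eq_fun do rewrite big_nil; exact: cvg_cst.
by under eq_fun do rewrite big_cons; apply: cvgD; [exact: cF|exact: IHr].
Qed.

Section expectation.
Context {d : nat} {R : realType}.
Variable mu : probability (bconfig d) R.
Implicit Types f g : config d -> R.

Lemma open_measurable_config (U : set (config d)) :
  open U -> measurable (U : set (bconfig d)).
Proof. by move=> oU; apply: sub_sigma_algebra. Qed.

Lemma continuous_measurable_config f :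
  continuous f -> measurable_fun setT (f : bconfig d -> R).
Proof.
move=> /continuousP cf; apply: (measurability _ (measurable_realfun.RGenOpens.measurableE R)).
move=> _ [_ [a [b ->] <-]]; rewrite setTI.
apply: open_measurable_config; apply: cf; exact: interval_open.
Qed.

Lemma continuous_integrable f :
  continuous f -> mu.-integrable setT (EFin \o (f : bconfig d -> R)).
Proof.
move=> cf; have [M M0 fM] := continuous_bounded cf.
apply: measurable_bounded_integrable => //.
- rewrite ltey_eq fin_num_measure//.
- exact: continuous_measurable_config.
- exists M; split; first exact: num_real.
  by move=> x Mx eta _; apply: le_trans (fM eta) _; exact: ltW.
Qed.

Definition expect f : R := \int[mu]_(eta in setT) f eta.

Lemma expect_integral f : continuous f ->
  (\int[mu]_eta (f eta)%:E)%E = (expect f)%:E.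
Proof.
by move=> /continuous_integrable fi; rewrite fineK//; exact: integrable_fin_num.
Qed.

Lemma expectD f g : continuous f -> continuous g ->
  expect (fun eta => f eta + g eta) = expect f + expect g.
Proof. by move=> cf cg; rewrite -RintegralD//; exact: continuous_integrable. Qed.

Lemma expectZ a f : continuous f ->
  expect (fun eta => a * f eta) = a * expect f.
Proof. by move=> cf; rewrite -RintegralZl//; exact: continuous_integrable. Qed.

Lemma expectB f g : continuous f -> continuous g ->
  expect (fun eta => f eta - g eta) = expect f - expect g.
Proof. by move=> cf cg; rewrite -RintegralB//; exact: continuous_integrable. Qed.

Lemma expect_cst a : expect (fun=> a) = a.
Proof. by rewrite /expect Rintegral_cst// -[RHS]mulr1; congr (_ * _); exact: (congr1 fine (probability_setT mu)). Qed.

Lemma expect_le f g : continuous f -> continuous g ->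
  (forall eta, f eta <= g eta) -> expect f <= expect g.
Proof.
by move=> cf cg fg; apply: le_Rintegral => //; exact: continuous_integrable.
Qed.

Lemma expect_dist f g e : continuous f -> continuous g ->
  (forall eta, `|f eta - g eta| <= e) -> `|expect f - expect g| <= e.
Proof.
move=> cf cg fg; rewrite -expectB//.
have cfg : continuous (fun eta => f eta - g eta).
  by move=> eta; exact: (cvgB (cf eta) (cg eta)).
have ce (a : R) : continuous (fun _ : config d => a) by move=> x; exact: cvg_cst.
rewrite ler_norml; apply/andP; split.
  rewrite -[leLHS]expect_cst; apply: expect_le => // eta.
  by have := fg eta; rewrite ler_norml => /andP[].
rewrite -[leRHS]expect_cst; apply: expect_le => // eta.
by have := fg eta; rewrite ler_norml => /andP[].
Qed.

Lemma expect_sum (I : Type) (r : seq I) (F : I -> config d -> R) :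
  (forall i, continuous (F i)) ->
  expect (fun eta => \sum_(i <- r) F i eta) = \sum_(i <- r) expect (F i).
Proof.
move=> cF; elim: r => [|i r IHr].
  by rewrite big_nil -[RHS]expect_cst; congr expect; apply: funext => eta; rewrite big_nil.
rewrite big_cons -IHr -expectD//; first by congr expect; apply: funext => eta; rewrite big_cons.
exact: continuous_sum.
Qed.

Definition prob (U : set (config d)) : R := fine (mu U).

Lemma probE (U : set (config d)) :
  measurable (U : set (bconfig d)) -> mu U = (prob U)%:E.
Proof. by move=> mU; rewrite fineK// fin_num_measure. Qed.

Lemma prob_ge0 (U : set (config d)) : 0 <= prob U.
Proof. exact: fine_ge0. Qed.

Lemma prob_le (U V : set (config d)) : measurable (U : set (bconfig d)) ->
  measurable (V : set (bconfig d)) -> U `<=` V -> prob U <= prob V.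
Proof.
by move=> mU mV UV; rewrite -lee_fin -!probE//; apply: le_measure; rewrite ?inE.
Qed.

Lemma prob_setT : prob setT = 1.
Proof. exact: (congr1 fine (probability_setT mu)). Qed.

Lemma prob_le1 (U : set (config d)) : measurable (U : set (bconfig d)) -> prob U <= 1.
Proof. by move=> mU; rewrite -prob_setT prob_le. Qed.

Lemma expect_indic (U : set (config d)) :
  measurable (U : set (bconfig d)) -> expect \1_U = prob U.
Proof. by move=> mU; rewrite /expect /Rintegral integral_indic// setIT. Qed.

(** Continuity into the discrete finite space [X], stated without putting a topology on [X]. *)
Definition clopen_fibers (X : finType) (h : config d -> X) :=
  forall x, open (h @^-1` [set x]).

Lemma clopen_fibers_comp (X : finType) (h : config d -> X) (g : X -> R) :
  clopen_fibers h -> continuous (g \o h).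
Proof.
move=> ch eta U gU; rewrite nbhs_simpl /=.
apply: (@filterS _ _ _ (h @^-1` [set h eta])); last first.
  by apply: open_nbhs_nbhs; split.
by move=> z /= ->; exact: nbhs_singleton gU.
Qed.

Lemma expect_fin (X : finType) (h : config d -> X) (g : X -> R) :
  clopen_fibers h ->
  expect (g \o h) = \sum_(x : X) g x * prob (h @^-1` [set x]).
Proof.
move=> ch.
have cI x (a : R) : continuous (fun eta : config d => a * \1_(h @^-1` [set x]) eta).
  have -> : (fun eta : config d => a * \1_(h @^-1` [set x]) eta)
          = (fun y => a * (y == x)%:R : R) \o h.
    apply: funext => eta; rewrite indicE/=; congr (_ * _%:R); congr nat_of_bool.
    by apply/idP/eqP; rewrite inE.
  exact: clopen_fibers_comp.
have cI1 x : continuous (\1_(h @^-1` [set x]) : config d -> R).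
  by have := cI x 1; under eq_fun do rewrite mul1r.
have mI x : measurable (h @^-1` [set x] : set (bconfig d)).
  exact: open_measurable_config.
transitivity (expect (fun eta => \sum_(x : X) g x * \1_(h @^-1` [set x]) eta)).
  congr expect; apply: funext => eta /=; rewrite (bigD1 (h eta))//= big1 ?addr0.
    by rewrite indicE mem_set// mulr1.
  by move=> x xh; rewrite indicE memNset ?mulr0// => /= hx; rewrite hx eqxx in xh.
rewrite expect_sum//.
by apply: eq_bigr => x _; rewrite expectZ ?expect_indic.
Qed.

Lemma prob_fin (X : finType) (h : config d -> X) (P : pred X) :
  clopen_fibers h ->
  prob (h @^-1` [set x | P x]) = \sum_(x | P x) prob (h @^-1` [set x]).
Proof.
move=> ch; rewrite -expect_indic; last first.
  rewrite (_ : _ @^-1` _ = \bigcup_(x in [set x | P x]) h @^-1` [set x]).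
    apply: fin_bigcup_measurable => // x _; exact: open_measurable_config.
  by apply/seteqP; split => [eta /= Pe|eta [x Px /= ->]//]; exists (h eta).
transitivity (expect ((fun x => (P x)%:R) \o h)).
  congr expect; apply: funext => eta; rewrite indicE/=; congr (_%:R); congr nat_of_bool.
  by apply/idP/idP; rewrite inE.
rewrite expect_fin// [RHS]big_mkcond/=; apply: eq_bigr => x _.
by case: ifP; rewrite ?mul1r ?mul0r.
Qed.

End expectation.

(** * The pregenerator as a uniform limit of finite sums *)

Lemma uniform_approx_continuous {R : realType} {U : topologicalType} (f : U -> R) :
  (forall e, 0 < e -> exists2 g, continuous g & forall x, `|f x - g x| <= e) ->
  continuous f.
Proof.
move=> fg x; apply/cvgrPdist_lt => e e0.
have e40 : 0 < e / 4 by rewrite divr_gt0.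
have [g cg gf] := fg _ e40.
have /cvgrPdist_lt/(_ _ e40) := cg x.
apply: filterS => y gxy; have := gf x; have := gf y; move: gxy.
rewrite !ltr_norml !ler_norml => /andP[? ?] /andP[? ?] /andP[? ?].
by apply/andP; split; lra.
Qed.

Lemma sum_fset_const {R : pzRingType} {T : choiceType} (A : {fset T}) (c : R) :
  \sum_(x <- A) c = c * #|` A|%:R.
Proof. by rewrite big_const_seq count_predT iter_addr_0 mulr_natr. Qed.

Section infinite_sums.
Context {R : realType} {T : choiceType} (D : set T).
Implicit Types (F G : {fset T}) (a b : T -> R).

(** Take [F] with sum within [e] of the supremum of all finite sums: a disjoint [G] of sum above [e]
    would push the union past the supremum. *)
Lemma finite_sums_tail b M : (forall x, 0 <= b x) ->
  (forall G, (forall x, x \in G -> D x) -> \sum_(x <- G) b x <= M) ->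
  forall e, 0 < e -> exists2 F : {fset _}, (forall x, x \in F -> D x) &
    forall G, (forall x, x \in G -> D x /\ x \notin F) ->
      \sum_(x <- G) b x <= e.
Proof.
move=> b0 bM e e0.
pose S := [set \sum_(x <- G) b x | G in [set G : {fset T} | forall x, x \in G -> D x]].
have hS : has_sup S.
  split; first by exists (\sum_(x <- fset0) b x), fset0.
  by exists M => _ [G GD <-]; exact: bM.
have [_ [F FD <-] FS] := sup_adherent e0 hS.
exists F => // G GDF; rewrite leNgt; apply/negP => eG.
have : \sum_(x <- (F `|` G)%fset) b x <= sup S.
  apply: (ub_le_sup hS.2); exists (F `|` G)%fset => // x.
  by rewrite in_fsetU => /orP[/FD|/GDF[]].
rewrite (big_fsetID _ (fun x : T => x \in F))/=.
rewrite (_ : [fset x in _ | x \in F]%fset = F); last first.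
  by apply/fsetP => x; rewrite !inE andbC; case: (x \in F).
rewrite (_ : [fset x in _ | x \notin F]%fset = G); last first.
  apply/fsetP => x; rewrite !inE; have [xF|xF] := boolP (x \in F); last by rewrite andbT.
  by rewrite andbF; apply/esym/negP => /GDF[_ /negP].
by move=> h; have := ltrD FS eG; rewrite subrK ltNge h.
Qed.

Lemma esum_approx b F e : 0 <= e -> (forall x, 0 <= b x) ->
  (forall x, x \in F -> D x) ->
  (forall G, (forall x, x \in G -> D x /\ x \notin F) ->
    \sum_(x <- G) b x <= e) ->
  ((\sum_(x <- F) b x)%:E <= esum D (EFin \o b) <=
    (\sum_(x <- F) b x + e)%:E)%E.
Proof.
move=> e0 b0 FD Ge; apply/andP; split.
  apply: esum_ge; exists [set` F]; first by split => // x /FD.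
  by rewrite -fsbig_seq// sumEFin.
apply: ub_ereal_sup => _ [A [fA AD] <-].
rewrite fsbig_finite//= sumEFin lee_fin.
set B := fset_set A.
have BD x : x \in B -> D x by rewrite in_fset_set// inE => /AD.
rewrite (big_fsetID _ (fun x : T => x \in F))/= lerD//.
  rewrite [leRHS](big_fsetID _ (fun x : T => x \in B))/= (_ : [fset x in B | _]%fset = [fset x in F | x \in B]%fset).
    by rewrite lerDl sumr_ge0.
  by apply/fsetP => x; rewrite !inE andbC.
by apply: Ge => x; rewrite !inE => /andP[/BD].
Qed.

(** The sums of the positive and of the negative parts exceed their partial sums by amounts lying in
    [0, e], so the two errors differ by at most [e]. *)
Lemma rsum_approx a F e : 0 <= e -> (forall x, x \in F -> D x) ->
  (forall G, (forall x, x \in G -> D x /\ x \notin F) ->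
    \sum_(x <- G) `|a x| <= e) ->
  `|rsum D a - \sum_(x <- F) a x| <= e.
Proof.
move=> e0 FD Ge.
pose p x := Num.max (a x) 0; pose n x := Num.max (- a x) 0.
have p0 x : 0 <= p x by rewrite le_max lexx orbT.
have n0 x : 0 <= n x by rewrite le_max lexx orbT.
have pa x : p x <= `|a x| by rewrite ge_max ler_norm normr_ge0.
have na x : n x <= `|a x| by rewrite ge_max -normrN ler_norm normr_ge0.
have pE : (EFin \o a)^\+%E = EFin \o p.
  by apply: funext => x; rewrite funeposE /= EFin_max.
have nE : (EFin \o a)^\-%E = EFin \o n.
  by apply: funext => x; rewrite funenegE /= EFin_max.
have := @esum_approx p F e e0 p0 FD.
have := @esum_approx n F e e0 n0 FD.
rewrite /rsum pE nE.
case/(_ _)/andP; first by move=> G /Ge; apply: le_trans; exact: ler_sum.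
move=> n1 n2.
case/(_ _)/andP; first by move=> G /Ge; apply: le_trans; exact: ler_sum.
move=> p1 p2.
have pf : esum D (EFin \o p) \is a fin_num.
  by rewrite fin_numE; apply/andP; split; apply/eqP => h; rewrite h in p1 p2.
have nf : esum D (EFin \o n) \is a fin_num.
  by rewrite fin_numE; apply/andP; split; apply/eqP => h; rewrite h in n1 n2.
rewrite fineB//; move: p1 p2 n1 n2.
rewrite -(fineK pf) -(fineK nf) !lee_fin /= => p1 p2 n1 n2.
have -> : \sum_(x <- F) a x = \sum_(x <- F) p x - \sum_(x <- F) n x.
  rewrite -sumrB; apply: eq_bigr => x _; rewrite /p /n.
  by have [?|?] := leP (a x) 0; have [?|?] := leP (- a x) 0; lra.
by rewrite ler_norml; apply/andP; split; lra.
Qed.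

End infinite_sums.

Section rate_sums.
Context {R : realType} {d : nat} (q : finperm d -> R).
Implicit Types (A : {fset site d}) (F G : {fset finperm d}) (s : finperm d).

Definition touches A s := has (fun x => s x != x) A.

Lemma moved_inv s x : (fperm_inv s x != x) = (s x != x).
Proof.
congr (~~ _); apply/eqP/eqP => [sx|sx]; last by rewrite -{1}sx fpermK.
by rewrite -{1}sx fperm_invK.
Qed.

Lemma act_fixes A s (f : config d -> R) eta :
  (forall eta zeta, (forall x, x \in A -> eta x = zeta x) -> f eta = f zeta) ->
  ~~ touches A s -> f (act s eta) = f eta.
Proof.
move=> fA /hasPn sA; apply: fA => x /sA /negPn; rewrite -(negbK (_ == _)).
by rewrite -moved_inv negbK /act => /eqP->.
Qed.

Lemma local_act s (f : config d -> R) : local f -> local (f \o act s).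
Proof.
move=> [A fA]; exists [fset fperm_inv s x | x in A]%fset => eta zeta ez /=.
by apply: fA => x xA; apply: ez; apply/imfsetP; exists x.
Qed.

Hypothesis q0 : forall s, 0 <= q s.
Hypothesis qb : bounded_total_rates q.

(** Restates the summability assumption with a real constant and finite sums, the form used in all
    later estimates. *)
Lemma total_rate_bound : exists2 M, 0 <= M & forall x G,
  (forall s, s \in G -> active q s /\ s x != x) -> \sum_(s <- G) q s <= M.
Proof.
have qsup x : (\esum_(s in active q `&` [set s | moved s x]) (q s)%:E <=
    ereal_sup [set \esum_(s in active q `&` [set s | moved s x]) (q s)%:E
             | x in [set: site d]])%E.
  by apply: ereal_sup_ubound; exists x.
move: qb; rewrite /bounded_total_rates.
set S := ereal_sup _ => Soo.
have S0 : (0 <= S)%E.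
  by apply: le_trans (qsup 0); apply: esum_ge0 => s _; rewrite lee_fin.
exists (fine S); first exact: fine_ge0.
move=> x G GD; rewrite -lee_fin fineK ?ge0_fin_numE//.
apply: le_trans (qsup x); apply: esum_ge; exists [set` G].
  by split => // s /GD.
by rewrite -fsbig_seq// sumEFin.
Qed.

(** Each permutation of [G] is counted at least once when the rates are summed over the points of
    [A] that it moves. *)
Lemma touching_rate_bound M A G :
  (forall x G, (forall s, s \in G -> active q s /\ s x != x) ->
     \sum_(s <- G) q s <= M) ->
  (forall s, s \in G -> active q s /\ touches A s) ->
  \sum_(s <- G) q s <= M * #|` A|%:R.
Proof.
move=> qM GA.
apply: (@le_trans _ _ (\sum_(s <- G) \sum_(x <- A | s x != x) q s)).
  rewrite !big_seq; apply: ler_sum => s /GA[_ /hasP[x xA sx]].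
  by rewrite big_fset_condE (big_fsetD1 x) ?inE ?xA ?sx//= lerDl sumr_ge0.
rewrite (exchange_big_dep xpredT)//= -sum_fset_const; apply: ler_sum => x _.
rewrite big_fset_condE; apply: (qM x) => s; rewrite !inE => /andP[/GA[] //].
Qed.

Lemma pregenerator_approx f e : local f -> 0 < e ->
  exists2 F : {fset _}, (forall s, s \in F -> active q s) & forall F' : {fset finperm d},
    (F `<=` F')%fset -> (forall s, s \in F' -> active q s) -> forall eta,
    `|pregenerator q f eta - \sum_(s <- F') q s * (f (act s eta) - f eta)| <= e.
Proof.
move=> lf e0; have [C C0 fC] := continuous_bounded (local_continuous lf).
have [A fA] := lf; have [M M0 qM] := total_rate_bound.
pose D : set (finperm d) := [set s | active q s /\ touches A s].
(* Each jump of [f] is at most 2 * C in absolute value; the added 1 keeps the denominator positive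
   when C = 0. *)
have e1 : 0 < e / (2 * C + 1) by rewrite divr_gt0// ltr_wpDl// mulr_ge0.
have [F FD Ftail] := @finite_sums_tail _ _ D q _ q0 (fun G => @touching_rate_bound M A G qM) _ e1.
exists F => [s /FD[]//|F' FF' F'a eta].
apply: rsum_approx => //; first exact: ltW.
move=> G GF'; rewrite (big_fsetID _ (touches A))/= [X in _ + X]big_seq.
rewrite [X in _ + X]big1 ?addr0; last first.
  by move=> s; rewrite !inE => /andP[_ sA]; rewrite (act_fixes _ fA)// subrr mulr0 normr0.
apply: (@le_trans _ _ (\sum_(s <- [fset s in G | touches A s]%fset) (2 * C) * q s)).
  apply: ler_sum => s _; rewrite normrM (ger0_norm (q0 s)) mulrC ler_wpM2r//.
  by rewrite (le_trans (ler_normB _ _))// mulr_natl mulr2n lerD.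
rewrite -mulr_sumr.
apply: (@le_trans _ _ (2 * C * (e / (2 * C + 1)))).
  apply: ler_wpM2l; first exact: mulr_ge0.
  apply: Ftail => s; rewrite !inE => /andP[/GF'[? sF'] ?]; split => //.
  by apply: contra sF'; exact/fsubsetP.
rewrite mulrCA ger_pMr// ler_pdivrMr ?mul1r ?lerDl// ltr_wpDl// mulr_ge0//.
Qed.

Lemma continuous_jump f s : local f -> continuous (fun eta => q s * (f (act s eta) - f eta)).
Proof.
move=> lf; apply: local_continuous.
have [A fA] := lf; have [B fB] := local_act s lf.
exists (A `|` B)%fset => eta zeta ez; congr (_ * (_ - _)).
  by apply: fB => x xB; apply: ez; rewrite in_fsetU xB orbT.
by apply: fA => x xA; apply: ez; rewrite in_fsetU xA.
Qed.

Lemma pregenerator_continuous f : local f -> continuous (pregenerator q f).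
Proof.
move=> lf; apply: uniform_approx_continuous => e e0.
have [F Fa /(_ F)] := pregenerator_approx lf e0.
move=> /(_ (fsubset_refl _) Fa) Fe.
exists (fun eta => \sum_(s <- F) q s * (f (act s eta) - f eta)) => //.
by apply: continuous_sum => s; exact: continuous_jump.
Qed.

(** Having the bound for every finite [F'] above [F] makes it possible to include any prescribed
    active permutations in the sum. *)
Lemma expect_pregenerator (mu : probability (bconfig d) R) f e : local f -> 0 < e ->
  exists2 F : {fset _}, (forall s, s \in F -> active q s) & forall F' : {fset finperm d},
    (F `<=` F')%fset -> (forall s, s \in F' -> active q s) ->
    `|expect mu (pregenerator q f) -
      \sum_(s <- F') q s * (expect mu (f \o act s) - expect mu f)| <= e.
Proof.
move=> lf e0; have [F Fa FE] := pregenerator_approx lf e0.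
exists F => // F' FF' F'a.
have -> : \sum_(s <- F') q s * (expect mu (f \o act s) - expect mu f) =
    expect mu (fun eta => \sum_(s <- F') q s * (f (act s eta) - f eta)).
  rewrite expect_sum => [|s]; last exact: continuous_jump.
  apply: eq_bigr => s _.
  have cs : continuous (f \o act s) by apply/local_continuous/local_act.
  have cf := local_continuous lf.
  rewrite -expectB// -expectZ// => eta; exact: (cvgB (cs eta) (cf eta)).
apply: expect_dist; [exact: pregenerator_continuous| |exact: FE].
by apply: continuous_sum => s; exact: continuous_jump.
Qed.

End rate_sums.

(** * Stationarity and the generator *)

Section feller_contraction.
Context {R : realType} {d : nat} (T : R -> (config d -> R) -> config d -> R).
Hypothesis TF : feller_semigroup T.
Implicit Types f g : config d -> R.

Lemma continuous_cst (a : R) : continuous (fun _ : config d => a).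
Proof. by move=> x; exact: cvg_cst. Qed.

Lemma continuous_affine (a : R) f g : continuous f -> continuous g ->
  continuous (fun eta => a * f eta + g eta).
Proof.
move=> cf cg eta.
have caf : a * f x @[x --> eta] --> a * f eta by exact: cvgZr (cf eta).
exact: (cvgD caf (cg eta)).
Qed.

Lemma semigroupB t f g : 0 <= t -> continuous f -> continuous g ->
  T t (fun eta => f eta - g eta) = (fun eta => T t f eta - T t g eta).
Proof.
move=> t0 cf cg.
have -> : (fun eta => f eta - g eta) = (fun eta => -1 * g eta + f eta).
  by apply: funext => eta; rewrite mulN1r addrC.
by rewrite (fs_linear TF)//; apply: funext => eta; rewrite mulN1r addrC.
Qed.

Lemma semigroupZ t a f : 0 <= t -> continuous f ->
  T t (fun eta => a * f eta) = (fun eta => a * T t f eta).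
Proof.
move=> t0 cf.
have -> : (fun eta => a * f eta) = (fun eta => a * f eta - (0 * f eta)).
  by apply: funext => eta; rewrite mul0r subr0.
have c0 : T t (fun eta => 0 * f eta) = fun=> 0.
  have -> : (fun eta => 0 * f eta) = (fun eta => f eta - f eta).
    by apply: funext => eta; rewrite mul0r subrr.
  by rewrite semigroupB//; apply: funext => eta; rewrite subrr.
have cc : continuous (fun eta => 0 * f eta).
  by under eq_fun do rewrite mul0r; exact: continuous_cst.
have -> : (fun eta => a * f eta - (0 * f eta)) = (fun eta => a * f eta + 0 * f eta).
  by apply: funext => eta; rewrite mul0r subr0 addr0.
by rewrite (fs_linear TF)// c0; apply: funext => eta; rewrite addr0.
Qed.

Lemma semigroup_le t f g : 0 <= t -> continuous f -> continuous g ->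
  (forall eta, f eta <= g eta) -> forall eta, T t f eta <= T t g eta.
Proof.
move=> t0 cf cg fg eta; rewrite -subr_ge0.
have := fs_ge0 TF t0 _ (f := fun eta => g eta - f eta).
rewrite semigroupB//; apply; last by move=> z; rewrite subr_ge0.
by move=> z; exact: (cvgB (cg z) (cf z)).
Qed.

Lemma semigroup_dist t f g e : 0 <= t -> continuous f -> continuous g ->
  (forall eta, `|f eta - g eta| <= e) ->
  forall eta, `|T t f eta - T t g eta| <= e.
Proof.
move=> t0 cf cg fg eta.
have ce : T t (fun=> e) = fun=> e.
  have -> : (fun=> e) = (fun eta : config d => e * 1).
    by apply: funext => z; rewrite mulr1.
  rewrite semigroupZ ?fs_one//; exact: continuous_cst.
have cfg : continuous (fun eta => f eta - g eta).
  by move=> z; exact: (cvgB (cf z) (cg z)).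
have cgf : continuous (fun eta => g eta - f eta).
  by move=> z; exact: (cvgB (cg z) (cf z)).
have := semigroup_le t0 cfg (continuous_cst (a := e)) _ eta.
have := semigroup_le t0 cgf (continuous_cst (a := e)) _ eta.
rewrite ce !semigroupB// ler_norml => h1 h2; apply/andP; split.
  rewrite lerNl opprB h1// => z; have := fg z.
  by rewrite ler_norml lerNl opprB => /andP[].
by rewrite h2// => z; have := fg z; rewrite ler_norml => /andP[].
Qed.

(* Commuting [T t] past the difference quotient makes it converge at a rate
   that does not depend on [t]. *)
Lemma generator_uniform f g : generator T f g -> forall e, 0 < e ->
  \forall h \near 0^'+, forall t, 0 <= t -> forall eta,
    `|T t g eta - h^-1 * (T (t + h) f eta - T t f eta)| <= e.
Proof.
move=> [cf cg /uniform_cvgP fg] e e0.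
near=> h => t t0 eta.
have h0 : 0 < h by near: h; exact: nbhs_right_gt.
have cTh : continuous (T h f) by apply: fs_continuous => //; exact: ltW.
have cd : continuous (fun eta => T h f eta - f eta).
  by move=> z; exact: (cvgB (cTh z) (cf z)).
rewrite (_ : _ * _ = T t (fun eta => h^-1 * (T h f eta - f eta)) eta).
  apply: semigroup_dist => //.
    by move=> z; exact: (cvgZr (k := h^-1) (cd z)).
  by move=> z; apply/ltW; move: z; near: h; exact: fg.
rewrite semigroupZ// semigroupB//; congr (_ * (_ - _)).
by rewrite -(fs_add TF)//; exact: ltW.
Unshelve. all: by end_near. Qed.

Lemma generator_semigroup f g t : 0 <= t ->
  generator T f g -> generator T (T t f) (T t g).
Proof.
move=> t0 fg; have [cf cg _] := fg; split; [exact: fs_continuous..|].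
apply/uniform_cvgP => e e0.
have e20 : 0 < e / 2 by rewrite divr_gt0.
apply: filterS (filterI (generator_uniform fg e20) (nbhs_right_gt 0)) => h [hf h0] eta.
rewrite -(fs_add TF)// ?(ltW h0)// (addrC h); apply: le_lt_trans (hf t t0 eta) _.
by rewrite ltr_pdivrMr// ltr_pMr// ltr1n.
Qed.

End feller_contraction.

Section stationarity.
Context {R : realType} {d : nat} (q : finperm d -> R).
Variables (T : R -> (config d -> R) -> config d -> R).
Hypothesis q0 : forall s, 0 <= q s.
Hypothesis qb : bounded_total_rates q.
Hypothesis TP : permutation_semigroup q T.
Variable mu : probability (bconfig d) R.

Lemma local_generator f : local f -> generator T f (pregenerator q f).
Proof.
move=> lf; apply/(TP.2 _ _); exists (fun=> f); split => //;
  by apply/uniform_cvgP => e e0; apply: nearW => n eta; rewrite subrr normr0.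
Qed.

Lemma stationary_expect t f : stationary T mu -> 0 <= t -> continuous f ->
  expect mu (T t f) = expect mu f.
Proof.
move=> muT t0 cf; apply: EFin_inj; rewrite -!expect_integral//; first exact: muT.
exact: fs_continuous TP.1 _ _ t0 cf.
Qed.

(** By stationarity the difference quotients of the semigroup have mean zero, and they approximate
    the pregenerator uniformly. *)
Lemma stationary_balance : stationary T mu ->
  forall f, local f -> expect mu (pregenerator q f) = 0.
Proof.
move=> muT f lf; apply/eqP; rewrite -normr_eq0 eq_le normr_ge0 andbT.
have [cf cg _] := local_generator lf.
apply/ler_addgt0Pr => e e0; rewrite add0r.
have [h [/(_ _ (lexx 0)) hf h0]] := filter_ex (filterI
  (generator_uniform TP.1 (local_generator lf) e0) (nbhs_right_gt (0 : R))).
move: hf; rewrite add0r !(fs_id TP.1)// => hf.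
have cTh : continuous (T h f) by apply: fs_continuous TP.1 _ _ (ltW h0) cf.
have cd : continuous (fun eta => T h f eta - f eta).
  by move=> z; exact: (cvgB (cTh z) (cf z)).
have cq : continuous (fun eta => h^-1 * (T h f eta - f eta)).
  by move=> z; exact: (cvgZr (k := h^-1) (cd z)).
have := expect_dist mu cg cq hf.
by rewrite expectZ// expectB// stationary_expect ?(ltW h0)// subrr mulr0 subr0.
Qed.

(** The derivative of the mean of [T t f] is the mean of [T t g], which vanishes. The argument is
    discrete: [[0, t]] is cut into [n] steps of length [h], each changing the mean by at most h * (e
    / t), hence by at most [e] in total. *)
Lemma generator_constant f g : generator T f g ->
  (forall t, 0 <= t -> expect mu (T t g) = 0) ->
  forall t, 0 < t -> expect mu (T t f) = expect mu f.
Proof.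
move=> fg Tg0 t t0; have [cf cg _] := fg.
have cT s k : 0 <= s -> continuous k -> continuous (T s k).
  exact: fs_continuous TP.1 s k.
apply/eqP; rewrite -subr_eq0 -normr_eq0 eq_le normr_ge0 andbT.
apply/ler_addgt0Pr => e e0; rewrite add0r.
have et0 : 0 < e / t by rewrite divr_gt0.
have := generator_uniform TP.1 fg et0.
rewrite near_withinE => -[del /= del0 hdel].
(* Enough steps for [h] to fall below [del], the range in which the difference quotient is
   controlled. *)
pose n := (Num.truncn (t / del)).+1.
have n0 : 0 < n%:R :> R by rewrite ltr0n.
pose h := t / n%:R.
have h0 : 0 < h by rewrite divr_gt0.
have hd : h < del.
  by rewrite ltr_pdivrMr// mulrC -ltr_pdivrMr// truncnS_gt.
have step s : 0 <= s -> `|expect mu (T (s + h) f) - expect mu (T s f)| <= h * (e / t).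
  move=> s0.
  have c1 : continuous (T (s + h) f) by apply: cT => //; rewrite addr_ge0// ltW.
  have cd : continuous (fun eta => T (s + h) f eta - T s f eta).
    by move=> z; exact: (cvgB (c1 z) (cT _ _ s0 cf z)).
  have cq : continuous (fun eta => h^-1 * (T (s + h) f eta - T s f eta)).
    by move=> z; exact: (cvgZr (k := h^-1) (cd z)).
  have := expect_dist mu (cT _ _ s0 cg) cq (hdel h _ h0 s s0).
  rewrite Tg0// sub0r normrN expectZ// expectB//; last exact: cT.
  rewrite normrM gtr0_norm ?invr_gt0// mulrC ler_pdivrMr// mulrC; apply.
  by rewrite /= sub0r normrN gtr0_norm.
have iter k : `|expect mu (T (h *+ k) f) - expect mu f| <= (h * (e / t)) *+ k.
  elim: k => [|k IHk]; first by rewrite !mulr0n (fs_id TP.1)// subrr normr0.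
  rewrite !mulrSr -(subrKA (expect mu (T (h *+ k) f))).
  apply: le_trans (ler_normD _ _) _; rewrite addrC lerD//.
  by apply: step; rewrite mulrn_wge0// ltW.
have := iter n.
rewrite -(mulr_natr h) -(mulr_natr (h * _)) /h divfK ?gt_eqF//.
by rewrite mulrAC divfK ?gt_eqF// mulrC divfK ?gt_eqF.
Qed.

(** Since the generator is the closure of the pregenerator, mean zero passes to its whole range. For
    local [f] that range contains every [T s] applied to the pregenerator of [f], so the mean of
    [T t f] is constant in time; density of local functions gives the rest. *)
Lemma balance_stationary :
  (forall f, local f -> expect mu (pregenerator q f) = 0) -> stationary T mu.
Proof.
move=> bal t f t0 cf.
have cT s k : 0 <= s -> continuous k -> continuous (T s k).
  exact: fs_continuous TP.1 s k.
rewrite !expect_integral//; last exact: cT.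
congr EFin; move: t0; rewrite le_eqVlt => /predU1P[<-|t0].
  by rewrite (fs_id TP.1).
have gen0 k g : generator T k g -> expect mu g = 0.
  move=> kg; have [ck cg _] := kg.
  have /(TP.2 _ _)[u [lu _ /uniform_cvgP ug]] := kg.
  apply/eqP; rewrite -normr_eq0 eq_le normr_ge0 andbT.
  apply/ler_addgt0Pr => e e0; rewrite add0r.
  have [n un] := filter_ex (ug _ e0).
  have := expect_dist mu cg (pregenerator_continuous q0 qb (lu n)) (fun z => ltW (un z)).
  by rewrite bal// subr0.
have loc k : local k -> expect mu (T t k) = expect mu k.
  move=> lk; apply: (generator_constant (local_generator lk)) => // s s0.
  exact/gen0/(generator_semigroup TP.1 s0 (local_generator lk)).
apply/eqP; rewrite -subr_eq0 -normr_eq0 eq_le normr_ge0 andbT.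
apply/ler_addgt0Pr => e e0; rewrite add0r.
have e20 : 0 < e / 2 by rewrite divr_gt0.
have [g lg fg] := continuous_local_approx cf e20.
have cg := local_continuous lg.
have h1 := expect_dist mu cf cg fg.
have h2 := expect_dist mu (cT _ _ (ltW t0) cf) (cT _ _ (ltW t0) cg)
  (semigroup_dist TP.1 (ltW t0) cf cg fg).
move: h1 h2; rewrite (loc g lg) !ler_norml => /andP[? ?] /andP[? ?].
by apply/andP; split; lra.
Qed.

End stationarity.

(** * Exchangeable measures *)

Lemma countable_bigcup_measurable {disp : measure_display} {T : measurableType disp} {I : countType}
    (D : set I) (F : I -> set T) :
  (forall i, D i -> measurable (F i)) -> measurable (\bigcup_(i in D) F i).
Proof.
move=> mF; pose G n := if choice.unpickle n is Some i then (if i \in D then F i else set0) else set0.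
rewrite (_ : \bigcup_(i in D) F i = \bigcup_n G n).
  apply: bigcupT_measurable => n; rewrite /G.
  by case: choice.unpickle => // i; case: ifPn => //; rewrite inE => /mF.
apply/seteqP; split => [x [i Di Fx]|x [n _]].
  by exists (choice.pickle i) => //; rewrite /G choice.pickleK mem_set.
by rewrite /G; case: choice.unpickle => // i; case: ifPn => //; rewrite inE; exists i.
Qed.

(** * Occupation events as an intersection-stable generator of the Borel sets *)

Section occupation.
Context {d : nat}.
Implicit Types (A Z : {fset site d}).

Definition occupied A : set (config d) := [set eta | forall x, x \in A -> eta x = true].

Lemma open_occupied A : open (occupied A).
Proof.
by apply: (open_cylinder_stable (A := A)) => eta zeta ez o x xA; rewrite -ez// o.
Qed.

Lemma occupiedU A Z : occupied (A `|` Z)%fset = occupied A `&` occupied Z.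
Proof.
apply/seteqP; split => [eta o|eta [oA oZ] x].
  by split => x xA; apply: o; rewrite in_fsetU xA ?orbT.
by rewrite in_fsetU => /orP[/oA|/oZ].
Qed.

Definition pattern (A Z : {fset site d}) : set (config d) :=
  [set eta | forall x, x \in A -> eta x = (x \in Z)].

Lemma measurable_pattern A Z :
  (occupied @` [set: {fset site d}]).-sigma.-measurable (pattern A Z).
Proof.
have mo B : (occupied @` [set: {fset site d}]).-sigma.-measurable (occupied B).
  by apply: sub_sigma_algebra; exists B.
pose C x := if x \in Z then occupied [fset x]%fset else ~` occupied [fset x]%fset.
rewrite (_ : pattern A Z = \bigcap_(x in [set` A]) C x).
  apply: (@fin_bigcap_measurable _ (g_sigma_algebraType (occupied @` [set: {fset site d}]))) => //.
  move=> x _; rewrite /C; case: ifP => _; first exact: mo.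
  exact: (@measurableC _ (g_sigma_algebraType (occupied @` [set: {fset site d}]))).
apply/seteqP; split => [eta p x /= xA|eta p x xA].
  rewrite /C -(p x xA); case: ifPn => [ex y|ex o]; first by rewrite in_fset1 => /eqP->.
  by move: ex; rewrite o// in_fset1.
have := p x xA; rewrite /C; case: ifPn => [_|_ o]; first by apply; rewrite in_fset1.
by apply/negP => ex; apply: o => y; rewrite in_fset1 => /eqP->.
Qed.

(** An open set is a union of patterns on finite windows. There are only countably many of these,
    and each is a finite intersection of one-site occupation events and their complements. *)
Lemma measurable_configE :
  @measurable _ (bconfig d) = <<s @occupied @` setT >>.
Proof.
apply/seteqP; split => [|].
  apply: smallest_sub; first exact: smallest_sigma_algebra.
  move=> U oU; pose D := [set p : {fset site d} * {fset site d} | pattern p.1 p.2 `<=` U].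
  rewrite (_ : U = \bigcup_(p in D) pattern p.1 p.2).
    apply: (@countable_bigcup_measurable _ (g_sigma_algebraType (occupied @` [set: {fset site d}]))).
    by move=> p _; exact: measurable_pattern.
  apply/seteqP; split => [eta Ueta|eta [p]]; last exact.
  have [A AU] := cylinder_sub_nbhs (open_nbhs_nbhs (conj oU Ueta)).
  exists (A, [fset x in A | eta x]%fset).
    by move=> z /= pz; apply: AU => x xA; rewrite pz// !inE xA.
  by move=> x /= xA; rewrite !inE xA.
apply: smallest_sub; first exact: smallest_sigma_algebra.
by move=> _ [A _ <-]; apply: sub_sigma_algebra; exact: open_occupied.
Qed.

(** Uniqueness of finite measures on an intersection-stable generator; the whole space is the
    occupation event of the empty set. *)
Lemma occupied_measure_unique {R : realType} (m1 m2 : {measure set (bconfig d) -> \bar R}) :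
  (m1 setT < +oo)%E -> (forall A, m1 (occupied A) = m2 (occupied A)) ->
  forall E, measurable E -> m1 E = m2 E.
Proof.
move=> m1T m12 E mE.
have o0 : occupied fset0 = setT by apply/seteqP; split.
pose G : set (set (bconfig d)) := occupied @` [set: {fset site d}].
have GI : setI_closed G.
  by move=> _ _ [A _ <-] [B _ <-]; exists (A `|` B)%fset; rewrite ?occupiedU.
have GT (k : nat) : G setT by exists fset0.
have cT : \bigcup_(k : nat) [set: bconfig d] = setT.
  by apply/seteqP; split => // x _; exists 0%N.
apply: (@measure_unique _ R (bconfig d) G (fun=> setT) measurable_configE GI GT cT m1 m2 _ _ E mE) => //.
by move=> _ [A _ <-].
Qed.

End occupation.

(** * Configurations and measures pulled back along maps of the lattice *)

Section relabeling.
Context {d : nat} (b : site d -> site d).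

(** An arbitrary site map [b] covers the action of a permutation, the shifts and the embedding
    [avoid0] at once. *)
Definition relabel (eta : config d) : config d := fun x => eta (b x).

Lemma open_relabel (U : set (config d)) : open U -> open (relabel @^-1` U).
Proof.
move=> oU; rewrite openE => eta Ueta.
have [A AU] := cylinder_sub_nbhs (open_nbhs_nbhs (conj oU Ueta)).
apply: filterS (nbhs_cylinder [fset b x | x in A]%fset eta) => z zA.
by apply: AU => x xA; apply: zA; apply/imfsetP; exists x.
Qed.

Lemma measurable_relabel (E : set (bconfig d)) :
  measurable E -> measurable (relabel @^-1` E : set (bconfig d)).
Proof.
have mf : measurable_fun [set: bconfig d] (relabel : bconfig d -> bconfig d).
  apply: (measurability _ (erefl : @measurable _ (bconfig d) = <<s @open (config d) >>)).
  move=> _ [U oU <-]; rewrite setTI.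
  apply: open_measurable_config; exact: open_relabel.
by move=> mE; rewrite -[X in measurable X]setTI; exact: mf.
Qed.

Lemma relabel_occupied A : relabel @^-1` occupied A = occupied [fset b x | x in A]%fset.
Proof.
apply/seteqP; split => [eta o _ /imfsetP[x xA ->]|eta o x xA]; first exact: o.
by apply: o; apply/imfsetP; exists x.
Qed.

Definition mrelabel {R : realType} (m : set (bconfig d) -> \bar R) (E : set (bconfig d)) :=
  m (relabel @^-1` E).

Section measure.
Context {R : realType} (m : {measure set (bconfig d) -> \bar R}).

Let mrelabel0 : mrelabel m set0 = 0%E.
Proof. by rewrite /mrelabel preimage_set0 measure0. Qed.

Let mrelabel_ge0 E : (0 <= mrelabel m E)%E.
Proof. exact: measure_ge0. Qed.

Let mrelabel_sigma_additive : semi_sigma_additive (mrelabel m).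
Proof.
move=> F mF tF mUF; rewrite /mrelabel preimage_bigcup.
apply: measure_semi_sigma_additive.
- by move=> n; exact: measurable_relabel.
- apply/trivIsetP => /= i j _ _ ij; rewrite -preimage_setI.
  by move/trivIsetP : tF => /(_ _ _ _ _ ij) ->//; rewrite preimage_set0.
- by rewrite -preimage_bigcup; exact: measurable_relabel.
Qed.

HB.instance Definition _ := isMeasure.Build _ _ _ (mrelabel m)
  mrelabel0 mrelabel_ge0 mrelabel_sigma_additive.

End measure.

End relabeling.

Section restriction.
Context {d : nat} {R : realType}.
Implicit Types (A : {fset site d}) (eta : config d).

Definition restrict A eta : {ffun A -> bool} := [ffun x => eta (val x)].

Definition extend A (z : {ffun A -> bool}) : config d :=
  fun x => if insub x is Some y then z y else false.

Lemma extend_val A (z : {ffun A -> bool}) (x : A) : extend z (val x) = z x.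
Proof. by rewrite /extend valK. Qed.

Lemma restrictK A eta x : x \in A -> extend (restrict A eta) x = eta x.
Proof. by move=> xA; rewrite -[x]/(val [` xA]%fset) extend_val ffunE. Qed.

Lemma clopen_restrict A : clopen_fibers (restrict A).
Proof.
move=> z; apply: (open_cylinder_stable (A := A)) => eta zeta ez <-.
by apply/ffunP => x; rewrite !ffunE ez//; exact: valP.
Qed.

Lemma clopen_relabel (X : finType) (h : config d -> X) b :
  clopen_fibers h -> clopen_fibers (h \o relabel b).
Proof. by move=> ch x; exact: (@open_relabel d b _ (ch x)). Qed.

Lemma local_factor (f : config d -> R) : local f ->
  exists A, f = (f \o @extend A) \o restrict A.
Proof.
move=> [A fA]; exists A; apply: funext => eta /=.
by apply: fA => x xA; rewrite restrictK.
Qed.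

Lemma expect_relabel (mu : probability (bconfig d) R) b (f : config d -> R) :
  (forall E : set (bconfig d), measurable E -> mu (relabel b @^-1` E) = mu E) ->
  local f -> expect mu (f \o relabel b) = expect mu f.
Proof.
move=> mub /local_factor[A fE]; rewrite [in RHS]fE.
have -> : f \o relabel b = (f \o @extend A) \o (restrict A \o relabel b) by rewrite {1}fE.
have cA := @clopen_restrict A.
rewrite !expect_fin//; last exact: clopen_relabel.
apply: eq_bigr => x _; congr (_ * fine _).
by rewrite -[RHS]mub//; apply: open_measurable_config; exact: cA.
Qed.

End restriction.

(** * Exchangeability implies shift invariance and stationarity *)

Section exchangeable.
Context {d : nat} {R : realType}.
Implicit Types mu : probability (bconfig d) R.

(** Invariance under all finite permutations, expressed on the occupation events, which determine
    the measure: [c n] is the probability that [n] given sites are all occupied. *)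
Definition exchangeable mu :=
  exists c : nat -> R, forall A, prob mu (occupied A) = c #|` A|.

(** An injection preserves cardinalities, so the two measures agree on occupation events. Injections
    rather than bijections are treated with a view to [avoid0]. *)
Lemma exchangeable_relabel mu (b : site d -> site d) : injective b -> exchangeable mu ->
  forall E : set (bconfig d), measurable E -> mu (relabel b @^-1` E) = mu E.
Proof.
move=> bi [c muc] E mE.
apply/esym; apply: (occupied_measure_unique (m2 := mrelabel b mu)) => //.
  by rewrite ltey_eq fin_num_measure.
move=> A /=; rewrite /mrelabel relabel_occupied !probE.
- by rewrite !muc card_imfset.
- apply: open_measurable_config; exact: open_occupied.
- apply: open_measurable_config; exact: open_occupied.
Qed.

Lemma exchangeable_shift mu : exchangeable mu -> shift_invariant mu.
Proof.
move=> ex y A mA; apply: (exchangeable_relabel (b := fun x => x - y)) => //.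
exact: addIr.
Qed.

(** No permutation changes the mean of a local function, so every finite sum approximating the mean
    of the pregenerator is zero. *)
Lemma exchangeable_stationary (q : finperm d -> R) T mu :
  (forall s, 0 <= q s) -> bounded_total_rates q -> permutation_semigroup q T ->
  exchangeable mu -> stationary T mu.
Proof.
move=> q0 qb TP ex; apply: (balance_stationary q0 qb TP) => f lf.
apply/eqP; rewrite -normr_eq0 eq_le normr_ge0 andbT.
apply/ler_addgt0Pr => e e0; rewrite add0r.
have [F Fa /(_ F (fsubset_refl _) Fa)] := expect_pregenerator q0 qb mu lf e0.
rewrite big1 ?subr0// => s _.
rewrite (_ : expect _ (_ \o _) = expect mu f) ?subrr ?mulr0//.
apply: (expect_relabel (b := fperm_inv s)) => //.
by apply: exchangeable_relabel => //; exact: can_inj (fperm_invK s).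
Qed.

End exchangeable.

(** * Two entropy inequalities *)

Section finite_entropy.
Context {R : realType} {X : finType}.
Implicit Types p : X -> R.

Lemma ln_le_subr1 (x : R) : 0 < x -> ln x <= x - 1.
Proof.
move=> x0; rewrite -{1}(subrK 1 x) addrC; apply: le_ln1Dx.
by rewrite ltrBrDl subrr.
Qed.

(** From expR (- l) >= 1 - l follows expR l <= 1 / (1 - l), and for l <= 1 / 2 this fraction is
    below the quadratic. *)
Lemma expR_le_quadratic (l : R) : l <= 1 / 2 -> expR l <= 1 + l + 2 * l ^+ 2.
Proof.
move=> l2; have e0 := expR_gt0 l.
have : expR l * (1 - l) <= 1.
  rewrite -[leRHS](expRxMexpNx_1 l) ler_pM2l//; exact: expR_ge1Dx.
have -> : 1 + l + 2 * l ^+ 2 = (1 + l ^+ 2 * (1 - 2 * l)) / (1 - l).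
  by field; lra.
rewrite -ler_pdivlMr; last by lra.
move=> h; apply: le_trans h _; rewrite ler_pM2r ?invr_gt0; last by lra.
by rewrite lerDl mulr_ge0 ?sqr_ge0//; lra.
Qed.

(* The Gibbs variational bound for the relative entropy of [p'] with respect to
   [p], tested against a small multiple of the indicator of [E]. *)
Lemma entropy_gain p p' (tau : X -> X) (E : pred X) :
  injective tau -> (forall x, p' (tau x) = p x) ->
  (forall x, 0 <= p x) -> \sum_x p x = 1 -> (forall x, p x = 0 -> p' x = 0) ->
  (\sum_(x | E x) p' x - \sum_(x | E x) p x) ^+ 2 / 8 <=
  \sum_x (p x - p' x) * ln (p x).
Proof.
move=> taui p'tau p0 p1 pp'.
have taub : bijective tau := injF_bij taui.
have p'0 x : 0 <= p' x by case: taub => u _ tK; rewrite -(tK x) p'tau.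
have sumtau (g : R -> R) : \sum_x g (p x) = \sum_x g (p' x).
  rewrite [RHS](reindex tau)/=; last exact: onW_bij.
  by apply: eq_bigr => x _; rewrite p'tau.
have p'1 : \sum_x p' x = 1 by rewrite -(sumtau id).
set a := \sum_(x | E x) p' x; set c := \sum_(x | E x) p x.
have sub1 (r : X -> R) : (forall x, 0 <= r x) -> \sum_x r x = 1 ->
    0 <= \sum_(x | E x) r x <= 1.
  move=> r0 r1; rewrite sumr_ge0//= -r1 [leRHS](bigID E)/= lerDl sumr_ge0//.
have /andP[a0 a1] : 0 <= a <= 1 := sub1 _ p'0 p'1.
have /andP[c0 c1] : 0 <= c <= 1 := sub1 _ p0 p1.
(* This [l] maximises l * (a - c) - 2 * l ^ 2, with value (a - c) ^ 2 / 8. *)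
pose l := (a - c) / 4.
pose phi x := if E x then l else 0.
(* As [p'] rearranges [p], both have the same entropy, which turns the sum into the relative entropy
   of [p'] with respect to [p]. *)
have -> : \sum_x (p x - p' x) * ln (p x) = \sum_x p' x * (ln (p' x) - ln (p x)).
  under eq_bigr do rewrite mulrBl.
  rewrite sumrB (sumtau (fun y => y * ln y)) -sumrB.
  by apply: eq_bigr => x _; rewrite mulrBr.
apply: (@le_trans _ _ (\sum_x (p' x * phi x + p' x - p x * expR (phi x)))); last first.
  (* Termwise this is ln y <= y - 1 at y = p x * expR (phi x) / p' x; where p' x = 0 the left side
     is nonpositive. *)
  apply: ler_sum => x _; have := p'0 x; rewrite le_eqVlt => /predU1P[p'x|p'x].
    by rewrite -p'x !mul0r !add0r oppr_le0 mulr_ge0// expR_ge0.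
  have px : 0 < p x.
    by rewrite lt_neqAle p0 andbT eq_sym; apply: contraTneq p'x => /pp' ->; rewrite ltxx.
  have ee := expR_gt0 (phi x).
  have := @ln_le_subr1 (p x * expR (phi x) / p' x).
  rewrite divr_gt0 ?mulr_gt0// => /(_ isT).
  rewrite lnM ?posrE ?invr_gt0 ?mulr_gt0// lnM ?posrE// lnV ?posrE// expRK.
  rewrite lerBrDl ler_pdivlMr// => h.
  by have : 1 * p' x = p' x; [rewrite mul1r | nra].
rewrite sumrB big_split/= p'1.
have -> : \sum_x p' x * phi x = l * a.
  rewrite mulr_sumr [RHS]big_mkcond/=; apply: eq_bigr => x _.
  by rewrite /phi; case: ifP; rewrite ?mulr0// mulrC.
have -> : \sum_x p x * expR (phi x) = 1 + (expR l - 1) * c.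
  rewrite -[X in _ = X + _]p1 mulr_sumr [X in _ = _ + X]big_mkcond/= -big_split/=.
  by apply: eq_bigr => x _; rewrite /phi; case: ifP => _; rewrite ?expR0; ring.
have l2 : l <= 1 / 2 by rewrite /l; lra.
have el := expR_le_quadratic l2.
have h : (expR l - 1) * c <= (l + 2 * l ^+ 2) * c by apply: ler_wpM2r => //; lra.
have h2 : 2 * l ^+ 2 * c <= 2 * l ^+ 2 by rewrite ler_piMr// mulr_ge0// sqr_ge0.
have -> : (a - c) ^+ 2 / 8 = l * a - l * c - 2 * l ^+ 2 by rewrite /l; field.
by move: h; rewrite mulrDl; lra.
Qed.

(** Let [m] be the common image law under [pi]. As p <= m o pi, replacing ln p by ln (m o pi) in the
    [p'] part lowers the sum, and there [p'] may then be exchanged for [p]. What remains is the sum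
    of p * ln (p / m o pi), at least the sum of p - m o pi, hence at least 1 - N. *)
Lemma entropy_loss {Y : finType} (pi : X -> Y) (N : nat) p p' :
  (forall y, \sum_(x | pi x == y) p x = \sum_(x | pi x == y) p' x) ->
  (forall y, #|[pred x | pi x == y]| <= N)%N ->
  (forall x, 0 <= p x) -> (forall x, 0 <= p' x) ->
  \sum_x p x = 1 -> (forall x, p x = 0 -> p' x = 0) ->
  - N%:R <= \sum_x (p x - p' x) * ln (p x).
Proof.
move=> pip' piN p0 p'0 p1 pp'.
pose m y := \sum_(x | pi x == y) p x.
have m0 y : 0 <= m y by exact: sumr_ge0.
have pm x : p x <= m (pi x) by rewrite /m (bigD1 x)//= lerDl sumr_ge0.
have sumpi (r : X -> R) (g : Y -> R) :
    \sum_x r x * g (pi x) = \sum_y (\sum_(x | pi x == y) r x) * g y.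
  rewrite (partition_big pi xpredT)//=; apply: eq_bigr => y _.
  by rewrite mulr_suml; apply: eq_bigr => x /eqP->.
apply: (@le_trans _ _ (\sum_x (p x - m (pi x)))).
  rewrite sumrB p1 (@le_trans _ _ (1 - N%:R))//; first by rewrite lerDr.
  rewrite lerB//.
  have -> : \sum_x m (pi x) = \sum_y m y * (#|[pred x | pi x == y]|)%:R.
    rewrite (partition_big pi xpredT)//=; apply: eq_bigr => y _.
    under eq_bigr => x /eqP-> do [].
    by rewrite sumr_const mulr_natr.
  have m1 : \sum_y m y = 1.
    by rewrite -p1 [RHS](partition_big pi xpredT).
  rewrite -[leRHS]mul1r -[X in _ <= X * _]m1 mulr_suml; apply: ler_sum => y _.
  by apply: ler_wpM2l => //; rewrite ler_nat.
apply: (@le_trans _ _ (\sum_x p x * (ln (p x) - ln (m (pi x))))).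
  apply: ler_sum => x _; have := p0 x; rewrite le_eqVlt => /predU1P[<-|px].
    by rewrite mul0r add0r oppr_le0.
  have mx : 0 < m (pi x) by apply: lt_le_trans (pm x).
  have := @ln_le_subr1 (m (pi x) / p x); rewrite divr_gt0// => /(_ isT).
  rewrite lnM ?posrE ?invr_gt0// lnV ?posrE// lerBrDl ler_pdivlMr//.
  by move=> h; nra.
under eq_bigr do rewrite mulrBr.
rewrite sumrB (sumpi p (fun y => ln (m y))); under [X in _ - X]eq_bigr do rewrite pip'.
rewrite -(sumpi p' (fun y => ln (m y))) -sumrB; apply: ler_sum => x _.
rewrite [leRHS]mulrBl lerD2l lerN2.
have := p'0 x; rewrite le_eqVlt => /predU1P[<-|p'x]; first by rewrite !mul0r.
have px : 0 < p x.
  by rewrite lt_neqAle p0 andbT eq_sym; apply: contraTneq p'x => /pp' ->; rewrite ltxx.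
rewrite ler_pM2l// ler_ln ?posrE//; exact: lt_le_trans (pm x).
Qed.

End finite_entropy.

(** * Boxes and translates of permutations *)

Section folner.
Context {d : nat}.
Implicit Types (B L : {fset site d}).

Definition inner B L : {fset site d} :=
  [fset x in L | all (fun b => (x + b)%R \in L) B]%fset.

Definition box_point n (v : {ffun 'I_d -> 'I_n}) : site d := \row_i (v i : nat)%:Z.

Lemma box_point_inj n : injective (@box_point n).
Proof.
move=> v w /matrixP vw; apply/ffunP => i; have := vw 0 i.
by rewrite !mxE => -[] /val_inj.
Qed.

Definition box n : {fset site d} := [fset box_point v | v in {: {ffun 'I_d -> 'I_n}}]%fset.

Lemma card_box n : #|` box n| = (n ^ d)%N.
Proof.
rewrite card_imfset; last exact: box_point_inj.
by rewrite /= -cardE card_ffun !card_ord.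
Qed.

Lemma mem_box n (x : site d) : (forall i, 0 <= x 0 i < n%:Z) -> x \in box n.
Proof.
move=> xn.
have xlt i : (absz (x 0%R i) < n)%N by have := xn i; lia.
apply/imfsetP; exists [ffun i => Ordinal (xlt i)] => //.
by apply/rowP => i; rewrite !mxE ffunE /=; have := xn i; lia.
Qed.

Lemma box_bounds n (x : site d) i : x \in box n -> 0 <= x 0 i < n%:Z.
Proof. by move=> /imfsetP[v _ ->]; rewrite mxE /= ltz_nat ltn_ord. Qed.

(** With [r] bounding the coordinates of the points of [B], the box of side [n] moved by [r] in
    every direction keeps a margin [r] inside the box of side n + 2 * r. *)
Lemma inner_box B : exists r, forall n, (n ^ d <= #|` inner B (box (n + 2 * r))|)%N.
Proof.
have [r br] : exists r, forall b i, b \in B -> (absz (b 0%R i) <= r)%N.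
  exists (\sum_(b <- B) \sum_i absz (b 0%R i))%N => b i bB.
  by rewrite (big_fsetD1 b)//= (bigD1 i)//=; lia.
have shift1 (a : int) (n : nat) : 0 <= a < n%:Z -> 0 <= a + r%:Z < (n + 2 * r)%:Z by lia.
have shift2 (a c : int) (n : nat) :
  0 <= a < n%:Z -> (absz c <= r)%N -> 0 <= a + r%:Z + c < (n + 2 * r)%:Z by lia.
exists r => n; rewrite -card_box.
have -> : #|` box n| = #|` [fset (x + const_mx r%:Z)%R | x in box n]%fset|.
  by rewrite [RHS]card_imfset //=; exact: addIr.
apply: fsubset_leq_card; apply/fsubsetP => _ /imfsetP[x /= xn ->].
have xi i := box_bounds i xn.
rewrite !inE /=; apply/andP; split.
  by apply: mem_box => i; rewrite !mxE; exact: shift1 (xi i).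
apply/allP => b bB; apply: mem_box => i; rewrite !mxE.
exact: shift2 (xi i) (br _ i bB).
Qed.

Lemma bernoulli_power {R : realDomainType} (x : R) n : 0 <= x <= 1 -> 1 - n%:R * x <= (1 - x) ^+ n.
Proof.
move=> /andP[x0 x1]; elim: n => [|n IHn]; first by rewrite mul0r subr0 expr0.
rewrite exprS; apply: le_trans (ler_wpM2l _ IHn); last by rewrite subr_ge0.
have : 0 <= n%:R * (x * x) by rewrite mulr_ge0// mulr_ge0.
by rewrite -natr1; nra.
Qed.

(** The inner proportion is at least (1 - x) ^ d with x = 2 * r / (n + 2 * r); Bernoulli's
    inequality bounds it below by 1 - d * x, which is at least 1 - k for the chosen [n]. *)
Lemma folner_exists {R : realType} B (k : R) : 0 < k -> exists L,
  (0 < #|` L|)%N /\ #|` L|%:R * (1 - k) <= #|` inner B L|%:R.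
Proof.
move=> k0; have [r rn] := inner_box B.
pose n := (Num.truncn (d%:R * (2 * r)%:R / k)).+1.
have nE : d%:R * (2 * r)%:R / k < n%:R by exact: truncnS_gt.
exists (box (n + 2 * r)); rewrite card_box; split; first by rewrite expn_gt0 addn_gt0.
apply: (@le_trans _ _ (n ^ d)%:R); last by rewrite ler_nat.
have m0 : 0 < (n + 2 * r)%:R :> R by rewrite ltr0n.
pose x : R := (2 * r)%:R / (n + 2 * r)%:R.
have x01 : 0 <= x <= 1.
  by rewrite /x divr_ge0//= ler_pdivrMr// mul1r ler_nat leq_addl.
have nx : n%:R = (n + 2 * r)%:R * (1 - x) :> R.
  by rewrite mulrBr mulr1 /x mulrC divfK ?gt_eqF// natrD addrK.
rewrite !natrX nx exprMn ler_wpM2l ?exprn_ge0//.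
apply: le_trans (bernoulli_power d x01); rewrite lerB//.
rewrite /x mulrA ler_pdivrMr//.
move: nE; rewrite ltr_pdivrMr// => /ltW /le_trans; apply.
by rewrite mulrC ler_pM2l// ler_nat leq_addr.
Qed.

End folner.

(** * Translates of a permutation and their supports *)

Section conjugate_permutations.
Context {d : nat}.
Implicit Types (s : finperm d) (y : site d).

Lemma conj_shiftE y s x : conj_shift y s x = s (x - y) + y.
Proof. by []. Qed.

Lemma conj_shift_moved y s x : (conj_shift y s x != x) = (s (x - y) != x - y).
Proof. by rewrite conj_shiftE -[in LHS](inj_eq (addIr (- y))) addrK. Qed.

Lemma conj_shift_add y z s : conj_shift y (conj_shift z s) = conj_shift (z + y) s.
Proof.
by apply: finperm_ext => x; rewrite !conj_shiftE opprD [- z - y]addrC !addrA.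
Qed.

Lemma conj_shift0 s : conj_shift 0 s = s.
Proof. by apply: finperm_ext => x; rewrite conj_shiftE subr0 addr0. Qed.

Lemma conj_shift_injr y : injective (conj_shift y).
Proof.
by move=> s t st; rewrite -(conj_shift0 s) -(conj_shift0 t) -(subrr y) -!conj_shift_add st.
Qed.

Definition support s : {fset site d} := fset_set (moved s).

Lemma in_support s x : (x \in support s) = (s x != x).
Proof.
by rewrite in_fset_set ?inE; last exact: fperm_finite; apply/idP/idP; rewrite inE.
Qed.

(* A translation preserving a nonempty finite set preserves its barycentre. *)
Lemma conj_shift_inj s x0 : s x0 != x0 -> injective (fun y => conj_shift y s).
Proof.
move=> sx0 y z yz.
have suppE w : support (conj_shift w s) = [fset (x + w)%R | x in support s]%fset.
  apply/fsetP => x; rewrite in_support conj_shift_moved.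
  apply/idP/imfsetP => [sx|[u /= us ->]]; last by rewrite addrK -in_support.
  by exists (x - w); rewrite ?subrK//= in_support.
have sumE w : \sum_(x <- support (conj_shift w s)) x =
    \sum_(x <- support s) x + w *+ #|` support s|.
  rewrite suppE big_imfset/=; last by move=> ? ? _ _; exact: addIr.
  by rewrite big_split/= [X in _ + X]big_const_seq count_predT iter_addr_0.
have := sumE y; rewrite yz sumE => /addrI /eqP.
rewrite eq_sym -subr_eq0 -mulrnBl => /eqP yz0.
apply/eqP; rewrite -subr_eq0; apply/eqP/rowP => i.
have := congr1 (fun v : site d => v 0 i) yz0; rewrite mulmxnE !mxE.
have s0 : (0 < #|` support s|)%N.
  by rewrite cardfs_gt0; apply/fset0Pn; exists x0; rewrite in_support.
by move=> /eqP; rewrite mulrn_eq0 -leqn0 leqNgt s0/= => /eqP.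
Qed.

End conjugate_permutations.

(** * Entropy production in a finite region *)

Section entropy_production.
Context {R : realType} {d : nat} (q : finperm d -> R).
Hypothesis q0 : forall s, 0 <= q s.
Hypothesis qb : bounded_total_rates q.
Variable mu : probability (bconfig d) R.
Hypothesis bal : forall f, local f -> expect mu (pregenerator q f) = 0.
Implicit Types (s : finperm d) (F G : {fset finperm d}) (A B L : {fset site d}).

(** The mean jumps weighted by the rates sum to zero. The crossing ones contribute at least - N * c,
    so any finite part of the others, all nonnegative, is at most N * c. *)
Lemma balance_bound f (N c : R) (cross : pred (finperm d)) F :
  local f -> 0 <= N ->
  (forall s, active q s -> ~~ cross s -> 0 <= expect mu (f \o act s) - expect mu f) ->
  (forall s, active q s -> cross s -> - N <= expect mu (f \o act s) - expect mu f) ->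
  (forall G, (forall s, s \in G -> active q s /\ cross s) -> \sum_(s <- G) q s <= c) ->
  (forall s, s \in F -> active q s /\ ~~ cross s) ->
  \sum_(s <- F) q s * (expect mu (f \o act s) - expect mu f) <= N * c.
Proof.
move=> lf N0; set b := fun s => expect mu (f \o act s) - expect mu f.
move=> b0 bN qc Fa; apply/ler_addgt0Pr => e e0.
have [F0 F0a F0E] := expect_pregenerator q0 qb mu lf e0.
have := F0E (F0 `|` F)%fset (fsubsetUl _ _).
rewrite bal// sub0r normrN.
have Fall s : s \in (F0 `|` F)%fset -> active q s.
  by rewrite in_fsetU => /orP[/F0a|/Fa[]].
move=> /(_ Fall); rewrite ler_norml => /andP[_].
rewrite (big_fsetID _ cross)/= => he.
have h1 : - (N * c) <= \sum_(s <- [fset s in (F0 `|` F)%fset | cross s]%fset) q s * b s.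
  set G := [fset s in _ | _]%fset.
  have GE s : s \in G -> active q s /\ cross s.
    by rewrite !inE /= => /andP[sF ?]; split => //; apply: Fall; rewrite in_fsetU.
  apply: (@le_trans _ _ (\sum_(s <- G) q s * - N)).
    by rewrite -mulr_suml mulrN lerN2 mulrC ler_wpM2l// qc.
  rewrite !big_seq; apply: ler_sum => s /GE[sa sc].
  by apply: ler_wpM2l => //; exact: bN.
have h2 : \sum_(s <- F) q s * b s <=
    \sum_(s <- [fset s in (F0 `|` F)%fset | ~~ cross s]%fset) q s * b s.
  set G := [fset s in _ | _]%fset.
  have GE s : s \in G -> active q s /\ ~~ cross s.
    by rewrite !inE /= => /andP[sF ?]; split => //; apply: Fall; rewrite in_fsetU.
  rewrite [leRHS](big_fsetID _ (fun s => s \in F))/=.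
  rewrite (_ : [fset s in G | s \in F]%fset = F).
    rewrite lerDl big_seq; apply: sumr_ge0 => s.
    by move=> /imfsetP[/= t /andP[/GE[sa sc] _] ->]; rewrite mulr_ge0// b0.
  apply/fsetP => s; rewrite !inE /=; have [sF|] := boolP (s \in F); last by rewrite andbF.
  by have [_ ->] := Fa _ sF; rewrite orbT.
by move: (lerD h1 h2) he; rewrite /b; lra.
Qed.

Lemma local_restrict L (g : {ffun L -> bool} -> R) : local (g \o restrict L).
Proof.
exists L => eta zeta ez /=; congr g; apply/ffunP => x.
by rewrite !ffunE ez//; exact: valP.
Qed.

Definition pattern_prob L (z : {ffun L -> bool}) : R :=
  prob mu (restrict L @^-1` [set z]).

Definition jumped_prob L s (z : {ffun L -> bool}) : R :=
  prob mu ((restrict L \o act s) @^-1` [set z]).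

Lemma clopen_act (X : finType) (h : config d -> X) s :
  clopen_fibers h -> clopen_fibers (h \o act s).
Proof. exact: clopen_relabel (fperm_inv s). Qed.

Lemma expect_jump L s (g : {ffun L -> bool} -> R) :
  expect mu ((g \o restrict L) \o act s) - expect mu (g \o restrict L) =
  \sum_z g z * (jumped_prob s z - pattern_prob z).
Proof.
have cL := @clopen_restrict d L.
rewrite (expect_fin mu g cL) (expect_fin mu g (clopen_act s cL)) -sumrB.
by apply: eq_bigr => z _; rewrite mulrBr.
Qed.

Lemma sum_pattern_prob L (P : pred {ffun L -> bool}) :
  \sum_(z | P z) pattern_prob z = prob mu (restrict L @^-1` [set z | P z]).
Proof. by rewrite prob_fin//; exact: clopen_restrict. Qed.

Lemma sum_jumped_prob L s (P : pred {ffun L -> bool}) :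
  \sum_(z | P z) jumped_prob s z = prob mu ((restrict L \o act s) @^-1` [set z | P z]).
Proof. by rewrite prob_fin//; apply: clopen_act; exact: clopen_restrict. Qed.

Lemma pattern_prob1 L : \sum_z @pattern_prob L z = 1.
Proof.
rewrite (sum_pattern_prob predT) -(prob_setT mu); congr prob.
by apply/seteqP; split.
Qed.

(** Absolute continuity, which makes the convention for the logarithm at 0 harmless. For the
    indicator of a null pattern every mean jump is nonnegative, so [balance_bound] without crossing
    permutations forces the jump by [s] to vanish. *)
Lemma jumped_prob0 L s (z : {ffun L -> bool}) :
  active q s -> pattern_prob z = 0 -> jumped_prob s z = 0.
Proof.
move=> sa z0; pose g w : R := (w == z)%:R.
have bE t : expect mu ((g \o restrict L) \o act t) - expect mu (g \o restrict L) = jumped_prob t z.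
  rewrite expect_jump (bigD1 z)//= /g eqxx mul1r z0 subr0 big1 ?addr0//.
  by move=> w /negbTE ->; rewrite mul0r.
have := @balance_bound (g \o restrict L) 0 0 pred0 [fset s]%fset (local_restrict (L := L) g) (lexx _).
rewrite big_seq_fset1 bE mul0r => H.
have : q s * jumped_prob s z <= 0.
  apply: H.
  - by move=> t _ _; rewrite bE prob_ge0.
  - by [].
  - by move=> G G0; rewrite big_seq big1// => t /G0[].
  - by move=> t; rewrite in_fset1 => /eqP->.
rewrite pmulr_rle0// => h; apply/eqP; rewrite eq_le h; exact: prob_ge0.
Qed.

(** The mean jump under [s] of minus the logarithm of the pattern probability. When the support of
    [s] lies in [L] it is a relative entropy. *)
Definition jump_entropy L s : R :=
  \sum_z (@pattern_prob L z - jumped_prob s z) * ln (pattern_prob z).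

Lemma fperm_inv_fix s x : (fperm_inv s x == x) = (s x == x).
Proof. by apply: negb_inj; exact: moved_inv. Qed.

(** A permutation supported in [L] acts on the patterns in [L] by an injection [tau], so the jumped
    law rearranges the pattern law and [entropy_gain] applies. *)
Lemma jump_inside L s (E : pred {ffun L -> bool}) :
  active q s -> (support s `<=` L)%fset ->
  (\sum_(z | E z) jumped_prob s z - \sum_(z | E z) pattern_prob z) ^+ 2 / 8 <=
  jump_entropy L s.
Proof.
move=> sa /fsubsetP sL.
have sLP x : x \in L -> s x \in L.
  move=> xL; have [->//|sx] := eqVneq (s x) x.
  by apply: sL; rewrite in_support; apply: contra_neq sx => /(can_inj (fpermK s)).
have sLV x : x \in L -> fperm_inv s x \in L.
  move=> xL; have [->//|sx] := eqVneq (fperm_inv s x) x.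
  apply: sL; rewrite in_support fperm_invK.
  by apply: contra_neq sx => {2}->.
pose tau (z : {ffun L -> bool}) := restrict L (act s (extend z)).
have tauE eta : restrict L (act s eta) = tau (restrict L eta).
  apply/ffunP => x; rewrite !ffunE /act restrictK//.
  exact/sLV/valP.
have taui : injective tau.
  move=> z w zw; apply/ffunP => x.
  have := congr1 (fun u : {ffun L -> bool} => u [` sLP _ (valP x)]%fset) zw.
  by rewrite !ffunE /= /act fpermK !extend_val.
apply: (@entropy_gain R _ (@pattern_prob L) (@jumped_prob L s) tau E taui).
- move=> z; congr prob; apply/seteqP; split => eta /=; rewrite tauE; last by move->.
  exact: taui.
- by move=> z; exact: prob_ge0.
- exact: pattern_prob1.
- by move=> z; exact: jumped_prob0.
Qed.

(** Let [pi] erase the values at the sites moved by [s]. What is left of the pattern is unaffected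
    by [s], and at most 2 ^ K patterns share the same remainder, so [entropy_loss] applies. *)
Lemma jump_crossing L s K : active q s -> (#|` support s| <= K)%N ->
  - (2 ^ K)%:R <= jump_entropy L s.
Proof.
move=> sa sK.
pose pi (z : {ffun L -> bool}) : {ffun L -> bool} :=
  [ffun x => (s (val x) == val x) && z x].
apply: (@entropy_loss R _ _ pi (2 ^ K) (@pattern_prob L) (@jumped_prob L s)).
- move=> z; rewrite (sum_pattern_prob (fun w => pi w == z)).
  rewrite (sum_jumped_prob s (fun w => pi w == z)).
  congr prob; apply/seteqP; split => eta /= /eqP piz; apply/eqP; rewrite -piz;
    apply/ffunP => x; rewrite !ffunE; case: eqP => //= sx;
    by congr (eta _); apply/eqP; rewrite ?fperm_inv_fix ?sx// eq_sym fperm_inv_fix sx.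
- move=> z; pose r (w : {ffun L -> bool}) : {ffun support s -> bool} := [ffun x => extend w (val x)].
  apply: (@leq_trans (2 ^ #|` support s|)); last by rewrite leq_exp2l.
  rewrite -card_bool (cardfE (support s)) -card_ffun.
  have ri : {in [pred w | pi w == z] &, injective r}.
    move=> w v; rewrite !inE => /eqP wz /eqP vz rwv; apply/ffunP => x.
    have [sx|sx] := eqVneq (s (val x)) (val x).
      have := congr1 (fun u : {ffun L -> bool} => u x) (etrans wz (esym vz)).
      by rewrite !ffunE sx eqxx.
    have xs : val x \in support s by rewrite in_support.
    have := congr1 (fun u : {ffun support s -> bool} => u [` xs]%fset) rwv.
    by rewrite !ffunE /= !extend_val.
  rewrite -(card_in_image ri); exact: max_card.
- by move=> z; exact: prob_ge0.
- by move=> z; exact: prob_ge0.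
- exact: pattern_prob1.
- by move=> z; exact: jumped_prob0.
Qed.

Lemma jump_away L s : ~~ touches L s -> jump_entropy L s = 0.
Proof.
move=> sL; rewrite /jump_entropy big1// => z _.
suff -> : jumped_prob s z = pattern_prob z by rewrite subrr mul0r.
congr prob; apply/seteqP; split => eta /= <-; apply/ffunP => x; rewrite !ffunE;
  by have /negPn := hasPn sL _ (valP x); rewrite -fperm_inv_fix /act => /eqP ->.
Qed.

Definition crosses L s := touches L s && ~~ (support s `<=` L)%fset.

(* Stationarity applied to [- ln] of the probability of the pattern in [L]. *)
Lemma entropy_balance L K (c : R) F :
  (forall s, active q s -> (#|` support s| <= K)%N) ->
  (forall G, (forall s, s \in G -> active q s /\ crosses L s) -> \sum_(s <- G) q s <= c) ->
  (forall s, s \in F -> active q s /\ (support s `<=` L)%fset) ->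
  \sum_(s <- F) q s * jump_entropy L s <= (2 ^ K)%:R * c.
Proof.
move=> sK qc Fa; pose g z := - ln (@pattern_prob L z).
have bE s : expect mu ((g \o restrict L) \o act s) - expect mu (g \o restrict L) = jump_entropy L s.
  by rewrite expect_jump; apply: eq_bigr => z _; rewrite mulNr -mulrN opprB mulrC.
have := @balance_bound (g \o restrict L) (2 ^ K)%:R c (crosses L) F (local_restrict (L := L) g).
under eq_bigr do rewrite bE.
apply => //.
- move=> s sa; rewrite bE negb_and negbK => /orP[/jump_away ->//|sL].
  apply: le_trans (jump_inside pred0 sa sL).
  by rewrite !big_pred0_eq subrr expr0n mul0r.
- by move=> s sa _; rewrite bE jump_crossing// sK.
- by move=> s /Fa[sa sL]; split => //; rewrite /crosses sL andbF.
Qed.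

End entropy_production.

(** * Invariance under active permutations *)

Section invariance.
Context {R : realType} {d : nat} (q : finperm d -> R).
Hypothesis q0 : forall s, 0 <= q s.
Hypothesis qb : bounded_total_rates q.
Hypothesis qs : shift_invariant_rates q.
Implicit Types (s : finperm d) (F G : {fset finperm d}) (A B L : {fset site d}).

Lemma active_conj_shift y s : active q s -> active q (conj_shift y s).
Proof. by rewrite /active /= -qs. Qed.

Lemma innerP B L x b : x \in inner B L -> b \in B -> x + b \in L.
Proof. by rewrite !inE => /andP[_ /allP]; apply. Qed.

(** Charge each crossing permutation to the points of [L] it moves. A point outside [inner B' L]
    receives at most [M]. At an inner point [x], translation by - x gives a permutation moving the
    origin whose support leaves [B']; it avoids the finite set [F1], so such permutations have total
    rate at most [e]. [B] is fixed before [L], and [B'] leaves room to enlarge it. *)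
Lemma crossing_rate M :
  (forall x G, (forall s, s \in G -> active q s /\ s x != x) -> \sum_(s <- G) q s <= M) ->
  forall e, 0 < e -> exists B, forall B' L G, (B `<=` B')%fset ->
  (forall s, s \in G -> active q s /\ crosses L s) ->
  \sum_(s <- G) q s <= M * (#|` L|%:R - #|` inner B' L|%:R) + e * #|` L|%:R.
Proof.
move=> qM e e0.
have M0 : 0 <= M by apply: le_trans (qM 0 fset0 _); rewrite ?big_seq_fset0.
have [F1 F1a F1e] := @finite_sums_tail _ _ [set s | active q s /\ s 0 != 0] q M q0 (qM 0) e e0.
exists (\bigcup_(s <- F1) support s)%fset => B' L G BB' Ga.
apply: (@le_trans _ _ (\sum_(s <- G) \sum_(x <- L | s x != x) q s)).
  rewrite !big_seq; apply: ler_sum => s /Ga[_ /andP[/hasP[x xL sx] _]].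
  by rewrite big_fset_condE (big_fsetD1 x) ?inE ?xL ?sx//= lerDl sumr_ge0.
rewrite (exchange_big_dep xpredT)//=.
apply: (@le_trans _ _ (\sum_(x <- L) (e + (M - (if x \in inner B' L then M else 0))))).
  rewrite !big_seq; apply: ler_sum => x xL; rewrite big_fset_condE.
  set Gx := [fset s in G | s x != x]%fset.
  have GxP s : s \in Gx -> s \in G /\ s x != x by rewrite !inE => /andP[].
  case: ifPn => [xB'|_]; last first.
    rewrite subr0 (@le_trans _ _ M)//; last by rewrite lerDr ltW.
    by apply: (qM x) => s /GxP[/Ga[]].
  rewrite subrr addr0.
  have -> : \sum_(s <- Gx) q s = \sum_(s <- [fset conj_shift (- x) s | s in Gx]%fset) q s.
    rewrite [RHS]big_imfset/=; last by move=> ? ? _ _; exact: conj_shift_injr.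
    by apply: eq_bigr => s _; rewrite -qs.
  apply: F1e => _ /imfsetP[s /= /GxP[sG sx] ->].
  have [sa /andP[_ sL]] := Ga _ sG.
  split.
    by split; [exact: active_conj_shift|rewrite conj_shift_moved opprK add0r].
  apply: contra sL => sF1; apply/fsubsetP => u us.
  rewrite -(subrKC x u); apply: (innerP xB'); apply: (fsubsetP BB').
  apply/bigfcupP; exists (conj_shift (- x) s); first by rewrite sF1.
  by rewrite in_support conj_shift_moved opprK subrK -in_support.
rewrite big_split/= sum_fset_const sumrB sum_fset_const.
rewrite [X in M * _ - X](_ : _ = M * #|` inner B' L|%:R); first by rewrite mulrBr addrC.
rewrite -sum_fset_const -big_mkcond big_fset_condE.
apply: eq_fbigl => x; rewrite !inE /=.
by case: (x \in L) => //=; rewrite andbb.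
Qed.

Lemma support_bound : bounded_range q -> exists K, forall s, active q s -> (#|` support s| <= K)%N.
Proof.
rewrite /bounded_range; set S := ereal_sup _ => Soo.
exists (Num.truncn (fine S)) => s sa.
have sS : ((#|` support s|%:R : R)%:E <= S)%E by apply: ereal_sup_ubound; exists s.
have Sf : S \is a fin_num.
  by rewrite ge0_fin_numE//; apply: le_trans sS; rewrite lee_fin.
move: sS; rewrite -(fineK Sf) lee_fin => sS.
by rewrite truncn_ge_nat// (le_trans _ sS).
Qed.

Variable mu : probability (bconfig d) R.
Hypothesis bal : forall f, local f -> expect mu (pregenerator q f) = 0.
Hypothesis mus : shift_invariant mu.

Lemma prob_occupied_shift A y :
  prob mu (occupied [fset (x + y)%R | x in A]%fset) = prob mu (occupied A).
Proof.
have -> : [fset (x + y)%R | x in A]%fset = [fset (x - (- y))%R | x in A]%fset.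
  by apply/fsetP => z; apply/imfsetP/imfsetP => -[x xA ->]; exists x; rewrite ?opprK.
rewrite -(relabel_occupied (fun x => x - (- y))).
congr fine; apply: (mus (- y)); apply: open_measurable_config; exact: open_occupied.
Qed.

Lemma act_occupied s A :
  act s @^-1` occupied A = occupied [fset fperm_inv s x | x in A]%fset.
Proof. exact: (relabel_occupied (fperm_inv s)). Qed.

Lemma restrict_occupied A L : (A `<=` L)%fset ->
  restrict L @^-1` [set z | all (extend z) A] = occupied A.
Proof.
move=> /fsubsetP AL; apply/seteqP; split => eta /=.
  by move=> /allP o x xA; have := o x xA; rewrite /= restrictK// AL.
by move=> o; apply/allP => x xA; rewrite restrictK ?AL// o.
Qed.

(** Apply [entropy_balance] in a large box [L]. The at least (1 - t) * |L| translates of [s] by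
    inner points each produce q s * del ^ 2 / 8 or more, while the crossing rate is at most (M + 1)
    * t * |L|. Dividing by |L| and taking [t] small forces [del] to vanish. *)
Lemma active_occupied s A : bounded_range q -> active q s ->
  prob mu (occupied [fset fperm_inv s x | x in A]%fset) = prob mu (occupied A).
Proof.
move=> qr sa.
(* The identity is treated apart because its translates all coincide, and the count below needs
   distinct ones. *)
have [/existsNP[x0 /eqP sx0]|/contrapT sid] := pselect (~ (forall x, s x = x)); last first.
  congr (prob mu (occupied _)); apply/fsetP => x.
  have sV y : fperm_inv s y = y by apply/eqP; rewrite fperm_inv_fix sid.
  by apply/imfsetP/idP => [[y /= yA ->]|xA]; [rewrite sV|exists x; rewrite ?sV].
have [K sK] := support_bound qr; have [M M0 qM] := total_rate_bound q0 qb.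
set A' := [fset _ | _ in A]%fset; set del := prob mu (occupied A') - prob mu (occupied A).
suff del0 t : 0 < t -> t <= 1 / 2 -> q s * (del ^+ 2 / 8) * (1 - t) <= (2 ^ K)%:R * (M + 1) * t.
  apply/eqP; rewrite -subr_eq0 -sqrf_eq0 -/del; apply: contraT => deln.
  have del2 : 0 < del ^+ 2 by rewrite lt_neqAle eq_sym deln sqr_ge0.
  have q1 : 0 < q s * (del ^+ 2 / 8) by rewrite mulr_gt0// divr_gt0.
  set Q := q s * _ in q1 del0; set C := (2 ^ K)%:R * _ in del0.
  have C0 : 0 <= C by rewrite mulr_ge0// addr_ge0.
  (* For this [t] the left side of [del0] is at least Q / 2 and the right side at most Q / 4. *)
  pose t := Q / (2 * (Q + C + C)).
  have QC : 0 < Q + C + C by rewrite -addrA ltr_wpDr// addr_ge0.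
  have t0 : 0 < t by rewrite divr_gt0// mulr_gt0.
  have tE : t * (2 * (Q + C + C)) = Q by rewrite divfK// gt_eqF// mulr_gt0.
  have t2 : t <= 1 / 2.
    by rewrite ler_pdivrMr ?mulr_gt0// mulrA divfK ?pnatr_eq0// mul1r -addrA lerDl addr_ge0.
  by have := del0 t t0 t2; nra.
move=> t0 t2.
have [B1 crossB] := crossing_rate qM t0.
(* [B1] serves the crossing estimate; [A] and the support of [s] are added so that their translates
   by inner points stay in [L]. *)
pose B := (B1 `|` (A `|` support s))%fset.
have [L [L0 Lin]] := folner_exists B t0.
have AB x u : x \in inner B L -> u \in A -> u + x \in L.
  by move=> xL uA; rewrite addrC (innerP xL)// !in_fsetU uA orbT.
have sB x u : x \in inner B L -> u \in support s -> u + x \in L.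
  by move=> xL us; rewrite addrC (innerP xL)// !in_fsetU us !orbT.
pose F := [fset conj_shift x s | x in inner B L]%fset.
have FE r : r \in F -> exists2 x, x \in inner B L & r = conj_shift x s.
  by move=> /imfsetP[x /= xL ->]; exists x.
have := @entropy_balance _ _ q q0 qb mu bal L K _ F sK
  (fun G => crossB B L G (fsubsetUl _ _)).
move=> /(_ _)/wrap[].
  move=> r /FE[x xL ->]; split; first exact: active_conj_shift.
  apply/fsubsetP => u; rewrite in_support conj_shift_moved -in_support => us.
  by rewrite -(subrK x u) sB.
have -> : \sum_(r <- F) q r * jump_entropy mu L r =
    \sum_(x <- inner B L) q s * jump_entropy mu L (conj_shift x s).
  rewrite [LHS]big_imfset/=; last by move=> y z _ _ /(conj_shift_inj sx0).
  by apply: eq_bigr => x _; rewrite -qs.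
(* The test event is that the translate of [A] by [x] is occupied; by shift invariance its
   probability changes by the same [del] for every [x]. *)
have jump x : x \in inner B L -> del ^+ 2 / 8 <= jump_entropy mu L (conj_shift x s).
  move=> xL; pose Ax := [fset (u + x)%R | u in A]%fset.
  have AxL : (Ax `<=` L)%fset.
    by apply/fsubsetP => _ /imfsetP[u /= uA ->]; exact: AB.
  have sxL : (support (conj_shift x s) `<=` L)%fset.
    apply/fsubsetP => u; rewrite in_support conj_shift_moved -in_support => us.
    by rewrite -(subrK x u) sB.
  have := jump_inside q0 qb bal (fun z => all (extend z) Ax) (active_conj_shift x sa) sxL.
  rewrite sum_jumped_prob sum_pattern_prob comp_preimage restrict_occupied// act_occupied.
  have -> : [fset fperm_inv (conj_shift x s) u | u in Ax]%fset = [fset (u + x)%R | u in A']%fset.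
    apply/fsetP => z; apply/imfsetP/imfsetP.
      move=> [_ /imfsetP[u /= uA ->] ->]; exists (fperm_inv s u) => /=.
        by apply/imfsetP; exists u.
      by rewrite addrK.
    move=> [_ /imfsetP[u /= uA ->] ->]; exists (u + x) => /=; last by rewrite addrK.
    by apply/imfsetP; exists u.
  by rewrite !prob_occupied_shift.
have lower : q s * (del ^+ 2 / 8) * (#|` L|%:R * (1 - t)) <=
    \sum_(x <- inner B L) q s * jump_entropy mu L (conj_shift x s).
  apply: (@le_trans _ _ (q s * (del ^+ 2 / 8) * #|` inner B L|%:R)).
    by rewrite ler_wpM2l// mulr_ge0// divr_ge0// sqr_ge0.
  rewrite -sum_fset_const !big_seq; apply: ler_sum => x xL.
  by rewrite ler_wpM2l// jump.
move=> /(le_trans lower).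
have L0' : 0 < #|` L|%:R :> R by rewrite ltr0n.
rewrite mulrCA mulrC => h.
rewrite -(ler_pM2r L0'); apply: le_trans h _.
rewrite -!mulrA ler_wpM2l//.
have : M * (#|` L|%:R - #|` inner B L|%:R) <= M * (#|` L|%:R * t).
  by rewrite ler_wpM2l//; lra.
by lra.
Qed.

End invariance.

(** * Swaps of two sites *)

Section swap.
Context {T : choiceType}.
Implicit Types (x y z u : T) (A B : {fset T}).

Definition swap x y u := if u == x then y else if u == y then x else u.

Lemma swapL x y : swap x y x = y.
Proof. by rewrite /swap eqxx. Qed.

Lemma swapR x y : swap x y y = x.
Proof. by rewrite /swap eqxx; case: eqVneq. Qed.

Lemma swapD x y u : u != x -> u != y -> swap x y u = u.
Proof. by rewrite /swap => /negbTE-> /negbTE->. Qed.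

Lemma swapK x y : involutive (swap x y).
Proof.
move=> u; rewrite /swap; have [->|ux] := eqVneq u x.
  by rewrite eqxx; case: eqVneq.
have [->|uy] := eqVneq u y; first by rewrite eqxx.
by rewrite (negbTE ux) (negbTE uy).
Qed.

Definition swap_fset x y A := [fset swap x y u | u in A]%fset.

Lemma card_swap x y A : #|` swap_fset x y A| = #|` A|.
Proof. by rewrite card_imfset//; exact: inv_inj (swapK x y). Qed.

Lemma in_swap x y A u : (u \in swap_fset x y A) = (swap x y u \in A).
Proof.
apply/imfsetP/idP => [[v /= vA ->]|uA]; first by rewrite swapK.
by exists (swap x y u); rewrite ?swapK.
Qed.

Lemma swapC x y A : swap_fset x y A = swap_fset y x A.
Proof.
by apply/fsetP => u; rewrite !in_swap /swap; have [->|] := eqVneq u x; case: eqVneq => // ->.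
Qed.

Lemma swap_same x y A : (x \in A) = (y \in A) -> swap_fset x y A = A.
Proof.
by move=> xy; apply/fsetP => u; rewrite in_swap /swap; case: eqVneq => [->//|_]; case: eqVneq => [->|].
Qed.

Lemma swap_trans x y z A : x != z -> y != z ->
  swap_fset x z A = swap_fset x y (swap_fset y z (swap_fset x y A)).
Proof.
move=> xz yz; apply/fsetP => u; rewrite !in_swap.
suff -> : swap x z u = swap x y (swap y z (swap x y u)) by [].
have zx : z != x by rewrite eq_sym.
have zy : z != y by rewrite eq_sym.
have [ux|ux] := eqVneq u x; first by rewrite ux !swapL (swapD zx zy).
have [uz|uz] := eqVneq u z; first by rewrite uz (swapD zx zy) !swapR.
have [uy|uy] := eqVneq u y; last by rewrite (swapD ux uz) (swapD ux uy) (swapD uy uz) (swapD ux uy).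
have yx : y != x by rewrite -uy.
have xy : x != y by rewrite eq_sym.
by rewrite uy (swapD yx yz) swapR (swapD xy xz) swapL.
Qed.

(** Swapping a point of A \ B with a point of B \ A lowers the cardinality of A \ B, on which the
    induction runs. *)
Lemma swap_invariant_card {U : Type} (g : {fset T} -> U) :
  (forall x y A, g (swap_fset x y A) = g A) ->
  forall A B, #|` A| = #|` B| -> g A = g B.
Proof.
move=> gs A B; move: {2}(#|` A `\` B|)%fset (leqnn #|` A `\` B|%fset) => n.
elim: n A => [|n IHn] A nAB AB.
  move: nAB; rewrite leqn0 cardfs_eq0 fsetD_eq0 => AsB.
  by congr g; apply/eqP; rewrite eqEfcard AsB AB leqnn.
have [AsB|] := boolP (A `<=` B)%fset.
  by congr g; apply/eqP; rewrite eqEfcard AsB AB leqnn.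
move=> /fsubsetPn[x xA xB].
have [BsA|] := boolP (B `<=` A)%fset.
  by congr g; apply/eqP; rewrite eq_sym eqEfcard BsA AB leqnn.
move=> /fsubsetPn[y yB yA].
rewrite -(gs x y); apply: IHn; last by rewrite card_swap.
rewrite -ltnS (leq_trans _ nAB)//; apply: fproper_ltn_card.
rewrite fproperE; apply/andP; split.
  apply/fsubsetP => u; rewrite !in_fsetD in_swap /swap; have [->|_] := eqVneq u x.
    by rewrite (negbTE yA) andbF.
  by have [->|_] := eqVneq u y; rewrite ?yB.
apply/fsubsetPn; exists x; first by rewrite in_fsetD xA xB.
by rewrite in_fsetD in_swap /swap eqxx (negbTE yA) andbF.
Qed.

End swap.

(** * Cyclic permutations given by duplicate-free sequences *)

Section cyclic_permutation.
Context {T : eqType}.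
Implicit Types (x y u : T) (p I J : seq T).

Lemma next_neq p u : uniq p -> (1 < size p)%N -> u \in p -> next p u != u.
Proof.
move=> pu p1 up; have [i p' pE] := rot_to up.
rewrite -(next_rot i pu) pE.
have : uniq (u :: p') by rewrite -pE rot_uniq.
have : (1 < size (u :: p'))%N by rewrite -pE size_rot.
case: p' {pE} => // v p' _ /=; rewrite eqxx !inE negb_or eq_sym.
by move=> /andP[/andP[]].
Qed.

Lemma next_notin p u : u \notin p -> next p u = u.
Proof. by move=> up; rewrite next_nth (negbTE up). Qed.

(** One step along the cycle replaces [x] by [y] in the block of sites [x :: I]. *)
Lemma next_block x y I J u : u \in x :: I -> next (x :: I ++ y :: J) u \in rcons I y.
Proof.
move=> uI.
have -> : next (x :: I ++ y :: J) u = nth x (I ++ y :: J) (index u ((x :: I) ++ y :: J)).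
  by rewrite next_nth -cat_cons mem_cat uI.
rewrite index_cat uI.
rewrite nth_cat mem_rcons inE; case: ltnP => [ltI|geI].
  by rewrite mem_nth ?orbT.
have : (index u (x :: I) <= size I)%N by rewrite -ltnS -/(size (x :: I)) index_mem.
by move=> leI; have -> : (index u (x :: I) = size I)%N by [apply/eqP; rewrite eqn_leq leI]; rewrite subnn eqxx.
Qed.

End cyclic_permutation.

(** * From active permutations to swaps of arbitrary sites *)

Section swaps_from_active.
Context {R : realType} {d : nat} (q : finperm d -> R).
Implicit Types (s : finperm d) (A : {fset site d}).

Lemma cycle_finperm (p : seq (site d)) : uniq p -> (1 < size p)%N ->
  exists s, fperm_inv s = next p /\ moved s = [set` p].
Proof.
move=> pu p1.
have fin : finite_set [set x | prev p x != x].
  apply: (@sub_finite_set _ _ [set` p]) => // x /=; apply: contraR => xp.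
  by rewrite prev_nth (negbTE xp).
exists (FinPerm (next_prev pu) (prev_next pu) fin); split => //.
apply/seteqP; split => x /=; rewrite /moved /=.
  by apply: contraR => xp; rewrite prev_nth (negbTE xp).
move=> xp; apply: contra_neq (next_neq pu p1 xp) => {1}<-.
by rewrite next_prev.
Qed.

Lemma derangement_swap s x y A : s x != x -> s y != y -> x \in A -> y \notin A ->
  exists t, moved t = moved s /\ [fset fperm_inv t u | u in A]%fset = swap_fset x y A.
Proof.
move=> sx sy xA yA.
have xy : x != y by apply: contraNneq yA => <-.
pose I := enum_fset ((support s `&` A) `\ x)%fset.
pose J := enum_fset ((support s `\` A) `\ y)%fset.
pose p := x :: I ++ y :: J.
have pE u : (u \in p) = (s u != u).
  rewrite -in_support /p !inE mem_cat inE /I /J !inE.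
  have [->|ux] := eqVneq u x; first by rewrite in_support sx.
  have [->|uy] := eqVneq u y; first by rewrite in_support sy orbT.
  by case: (u \in A); rewrite /= ?andbT ?andbF ?orbF.
have memI u : (u \in I) = [&& u != x, u \in support s & u \in A] by rewrite !inE.
have memJ u : (u \in J) = [&& u != y, u \notin A & u \in support s] by rewrite !inE.
have pu : uniq p.
  rewrite /p cons_uniq cat_uniq cons_uniq !fset_uniq mem_cat in_cons.
  rewrite memI !memJ !eqxx xA (negbTE xy) !andbF /= andbT negb_or.
  rewrite memI (negbTE yA) !andbF /=.
  by apply/hasPn => u; rewrite memI memJ => /and3P[_ /negbTE-> _]; rewrite !andbF.
have [|t [tE tm]] := cycle_finperm pu; first by rewrite /p /= size_cat /= addnS.
exists t; split.
  by rewrite tm; apply/seteqP; split => u /=; rewrite pE.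
apply/eqP; rewrite eqEfcard card_swap card_imfset ?leqnn ?andbT; last first.
  exact: can_inj (fperm_invK t).
apply/fsubsetP => _ /imfsetP[u /= uA ->]; rewrite in_swap tE.
have good v : v = y \/ (v \in A /\ v != x) -> swap x y v \in A.
  rewrite /swap => -[->|[vA vx]]; first by rewrite eq_sym (negbTE xy) eqxx.
  by rewrite (negbTE vx); case: eqVneq => // ->.
apply: good; have [uI|uI] := boolP (u \in x :: I).
  have := next_block y J uI; rewrite mem_rcons inE => /orP[/eqP ->|]; first by left.
  by rewrite /I !inE => /andP[vx /andP[_ vA]]; right.
right; have ux : u != x by apply: contraNneq uI => ->; rewrite inE eqxx.
rewrite next_notin// pE -in_support; apply: contra uI => us.
by rewrite inE (negbTE ux) /= /I !inE ux us uA.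
Qed.

Hypothesis qi : irreducible_rates q.
Hypothesis qc : range_closed q.

(** Two points moved by one active permutation may be swapped, in particular [x] and [s x] when they
    differ. Irreducibility links any two sites by such steps, and swaps along the chain compose by
    [swap_trans]. *)
Lemma active_invariant_card {U : Type} (g : {fset site d} -> U) :
  (forall s A, active q s -> g [fset fperm_inv s x | x in A]%fset = g A) ->
  forall A B, #|` A| = #|` B| -> g A = g B.
Proof.
move=> gq; apply: swap_invariant_card.
have pair_in s x y A : active q s -> s x != x -> s y != y ->
    x \in A -> y \notin A -> g (swap_fset x y A) = g A.
  move=> sa sx sy xA yA; have [t [tm <-]] := derangement_swap sx sy xA yA.
  by apply: gq; exact: qc sa tm.
have pair s x y A : active q s -> s x != x -> s y != y -> g (swap_fset x y A) = g A.
  move=> sa sx sy.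
  have [xA|xA] := boolP (x \in A); have [yA|yA] := boolP (y \in A).
  - by rewrite swap_same// xA yA.
  - exact: pair_in sa sx sy xA yA.
  - by rewrite swapC; exact: pair_in sa sy sx yA xA.
  - by rewrite swap_same// (negbTE xA) (negbTE yA).
have trans x y z : (forall A, g (swap_fset x y A) = g A) ->
    (forall A, g (swap_fset y z A) = g A) -> forall A, g (swap_fset x z A) = g A.
  move=> gxy gyz A; have [->|xz] := eqVneq x z; first by rewrite swap_same.
  have [<-//|yz] := eqVneq y z.
  by rewrite (swap_trans _ xz yz) gxy gyz gxy.
move=> x y; have [ss [sa <-]] := qi x y.
elim: ss x sa => [|s ss IHss] x sa A /=; first by rewrite swap_same.
apply: (trans x (s x)) => [B|]; last first.
  by apply: IHss => t tss; apply: sa; rewrite inE tss orbT.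
have [->|sx] := eqVneq (s x) x; first by rewrite swap_same.
apply: (pair s) => //; first by apply: sa; rewrite inE eqxx.
by apply: contra_neq sx => /(can_inj (fpermK s)).
Qed.

End swaps_from_active.

(** * Ergodicity of product measures *)

Section site_translations.
Context {d : nat} (i0 : 'I_d).
Implicit Types (A : {fset site d}).

Definition unit_site : site d := delta_mx 0 i0.

Lemma unit_siteE (k : int) : (unit_site *~ k) 0 i0 = k.
Proof.
have -> : unit_site *~ k = k *: unit_site by rewrite -scaler_int intz.
by rewrite !mxE !eqxx mulr1.
Qed.

(** Pushing the half-space of nonnegative [i0]-coordinate one step away frees the hyperplane of
    coordinate 0, hence the origin. *)
Definition avoid0 (x : site d) : site d := if 0 <= x 0 i0 then x + unit_site else x.

Lemma avoid0_coord x : avoid0 x 0 i0 = if 0 <= x 0 i0 then x 0 i0 + 1 else x 0 i0.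
Proof. by rewrite /avoid0; case: ifP => // _; rewrite !mxE !eqxx. Qed.

Lemma avoid0_inj : injective avoid0.
Proof.
move=> x y xy; have := congr1 (fun v : site d => v 0 i0) xy; rewrite !avoid0_coord.
move: xy; rewrite /avoid0; case: ifPn => hx; case: ifPn => hy //.
- by move=> /addIr.
- by move=> _ h; move: hx hy; rewrite -h; lia.
- by move=> _ h; move: hx hy; rewrite h; lia.
Qed.

Lemma avoid0_neq0 x : avoid0 x != 0.
Proof.
apply/eqP => /(congr1 (fun v : site d => v 0 i0)); rewrite avoid0_coord mxE.
by case: ifPn; lia.
Qed.

Lemma disjoint_translates A : exists y : nat -> site d, forall i j, i != j ->
  fdisjoint [fset (x + y i)%R | x in A]%fset [fset (x + y j)%R | x in A]%fset.
Proof.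
pose L := (\sum_(x <- A) absz (x 0%R i0))%N.
have AL x : x \in A -> (absz (x 0%R i0) <= L)%N.
  by move=> xA; rewrite /L (big_fsetD1 x)//= leq_addr.
(* The [i0]-coordinates of [A] lie in [- L, L], an interval of 2 * L + 1 integers, so steps of that
   length separate the translates. *)
exists (fun i => unit_site *~ (i * (2 * L).+1)%N) => i j ij.
apply/fdisjointP => _ /imfsetP[x /= xA ->]; apply/imfsetP => -[z /= zA].
move=> /(congr1 (fun v : site d => v 0 i0)).
rewrite mxE unit_siteE mxE unit_siteE.
have := AL _ xA; have := AL _ zA; move: (x 0 i0) (z 0 i0) L ij {AL} => a b L.
move=> ij bL aL.
have key m n : (m < n)%N -> (m * (2 * L).+1 + (2 * L).+1 <= n * (2 * L).+1)%N.
  by move=> mn; rewrite addnC -mulSn leq_mul2r mn orbT.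
move: ij; rewrite neq_ltn => /orP[] /key; move: (i * _)%N (j * _)%N => I J; lia.
Qed.

End site_translations.

Section ergodicity.
Context {R : realType} {d : nat}.
Implicit Types (A B : {fset site d}) (mu nu : probability (bconfig d) R).

Definition occupied_ind A (eta : config d) : R := (all eta A)%:R.

Lemma occupied_ind_continuous A : continuous (occupied_ind A).
Proof.
apply: local_continuous; exists A => eta zeta ez; congr (_%:R); congr nat_of_bool.
by apply: eq_in_all => x /ez.
Qed.

Lemma expect_occupied_ind mu A : expect mu (occupied_ind A) = prob mu (occupied A).
Proof.
rewrite -expect_indic; last by apply: open_measurable_config; exact: open_occupied.
congr expect; apply: funext => eta; rewrite indicE; congr (_%:R); congr nat_of_bool.
by apply/allP/idP; rewrite inE => h x /h.
Qed.

Lemma occupied_indM A B eta :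
  occupied_ind A eta * occupied_ind B eta = occupied_ind (A `|` B)%fset eta.
Proof.
rewrite -natrM mulnb; congr (_%:R); congr nat_of_bool.
apply/andP/allP => [[/allP hA /allP hB] x|h].
  by rewrite in_fsetU => /orP[/hA|/hB].
by split; apply/allP => x xA; apply: h; rewrite in_fsetU xA ?orbT.
Qed.

Lemma homogeneous_prob rho nu A : homogeneous_product rho nu ->
  prob nu (occupied A) = rho ^+ #|` A|.
Proof. by rewrite /prob => ->. Qed.

(* Second moments of the empirical frequency of [A] being occupied, over [N]
   disjoint translates: bounded by [N] under [nu], hence by [N / p] under [mu]. *)
Lemma dominated_homogeneous rho nu mu (p : R) A : (0 < d)%N ->
  homogeneous_product rho nu -> shift_invariant mu -> 0 < p ->
  (forall E : set (bconfig d), measurable E -> p * prob mu E <= prob nu E) ->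
  prob mu (occupied A) = rho ^+ #|` A|.
Proof.
move=> d0 nuh mus p0 pmu.
have [y ydis] := disjoint_translates (Ordinal d0) A.
set a := rho ^+ _; set v := prob mu _.
pose Y i := [fset (x + y i)%R | x in A]%fset.
have cardY i : #|` Y i| = #|` A| by rewrite card_imfset//; exact: addIr.
have nuY i : prob nu (occupied (Y i)) = a by rewrite (homogeneous_prob _ nuh) cardY.
have muY i : prob mu (occupied (Y i)) = v by exact: prob_occupied_shift.
have a01 : 0 <= a <= 1.
  rewrite -(nuY 0%N) prob_ge0 prob_le1//.
  by apply: open_measurable_config; exact: open_occupied.
pose u i (eta : config d) := occupied_ind (Y i) eta - a.
have cu i : continuous (u i).
  by move=> eta; apply: cvgB; [exact: occupied_ind_continuous|exact: cvg_cst].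
pose S N (eta : config d) := \sum_(i < N) u i eta.
have cS N : continuous (S N) by apply: continuous_sum => i; exact: cu.
have cuu i j : continuous (fun eta => u i eta * u j eta).
  by move=> eta; exact: (cvgM (cu i eta) (cu j eta)).
have cSS N : continuous (fun eta => S N eta * S N eta).
  by move=> eta; exact: (cvgM (cS N eta) (cS N eta)).
(* Disjoint translates are independent under [nu], so the centred indicators are orthogonal, each
   with the variance of a Bernoulli variable of parameter [a]. *)
have covE i j : expect nu (fun eta => u i eta * u j eta) = if i == j then a - a ^+ 2 else 0.
  have cI := @occupied_ind_continuous.
  have -> : (fun eta => u i eta * u j eta) = (fun eta => - a * occupied_ind (Y i) eta +
      (- a * occupied_ind (Y j) eta + (1 * occupied_ind (Y i `|` Y j)%fset eta + a ^+ 2))).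
    by apply: funext => eta; rewrite /u -occupied_indM; ring.
  have ca := @continuous_cst R d (a ^+ 2).
  have c1 := continuous_affine (a := 1) (cI (Y i `|` Y j)%fset) ca.
  have c2 := continuous_affine (a := - a) (cI (Y j)) c1.
  have cZ (b : R) B : continuous (fun eta => b * occupied_ind B eta).
    by move=> eta; exact: (cvgZr (k := b) (cI B eta)).
  rewrite expectD// expectZ// expectD// expectZ// expectD// expectZ// expect_cst.
  rewrite !expect_occupied_ind !nuY (homogeneous_prob _ nuh).
  case: eqVneq => [->|ij]; first by rewrite fsetUid cardY -/a; ring.
  have Yij0 : (Y i `&` Y j)%fset = fset0 by apply/eqP; rewrite fsetI_eq0 ydis.
  have := cardfsUI (Y i) (Y j); rewrite Yij0 cardfs0 addn0 !cardY => ->.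
  by rewrite exprD -/a; ring.
have SSE N eta : S N eta * S N eta = \sum_(i < N) \sum_(j < N) u i eta * u j eta.
  by rewrite mulr_suml; apply: eq_bigr => i _; rewrite mulr_sumr.
have nuSS N : expect nu (fun eta => S N eta * S N eta) <= N%:R.
  under eq_fun do rewrite SSE.
  rewrite expect_sum => [|i]; last by apply: continuous_sum => j; exact: cuu.
  apply: (@le_trans _ _ (\sum_(i < N) (1 : R))); last by rewrite sumr_const card_ord.
  apply: ler_sum => i _; rewrite expect_sum// (bigD1 i)//= covE eqxx big1 ?addr0.
    by have := sqr_ge0 a; lra.
  by move=> j ji; rewrite covE ifN// eq_sym.
have muS N : expect mu (S N) = N%:R * (v - a).
  rewrite expect_sum//; under eq_bigr => i _.
    rewrite expectB; [|exact: occupied_ind_continuous|exact: continuous_cst].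
    rewrite expect_cst expect_occupied_ind muY; over.
  by rewrite sumr_const card_ord mulr_natl.
(* The squared mean is at most the second moment, by integrating S ^ 2 >= 2 * t * S - t ^ 2 with [t]
   the mean. *)
have muSS N : (N%:R * (v - a)) ^+ 2 <= expect mu (fun eta => S N eta * S N eta).
  set t := N%:R * (v - a).
  have -> : t ^+ 2 = expect mu (fun eta => 2 * t * S N eta + - t ^+ 2).
    have cst := @continuous_cst R d (- t ^+ 2).
    rewrite expectD//; last by move=> eta; exact: (cvgZr (k := 2 * t) (cS N eta)).
    by rewrite expectZ// muS expect_cst -/t; ring.
  apply: expect_le => //; first by apply: continuous_affine => //; exact: continuous_cst.
  by move=> eta; have := sqr_ge0 (S N eta - t); nra.
(* Domination is given for events only, so the square is written as a nonnegative function of the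
   finite vector [h] and summed over its values. *)
have dom N : p * expect mu (fun eta => S N eta * S N eta) <=
    expect nu (fun eta => S N eta * S N eta).
  pose h (eta : config d) : {ffun 'I_N -> bool} := [ffun i => all eta (Y (val i))].
  have ch : clopen_fibers h.
    move=> z; apply: (open_cylinder_stable (A := (\bigcup_(i <- enum 'I_N) Y (val i))%fset)).
    move=> eta zeta ez <-; apply/ffunP => i; rewrite !ffunE; apply: eq_in_all => x xi.
    by rewrite ez//; apply/bigfcupP; exists i => //; rewrite mem_enum.
  pose g (z : {ffun 'I_N -> bool}) : R := \sum_(i < N) ((z i)%:R - a).
  have -> : (fun eta => S N eta * S N eta) = (fun z => g z * g z) \o h.
    by apply: funext => eta /=; congr (_ * _); apply: eq_bigr => i _; rewrite ffunE.
  rewrite !expect_fin// mulr_sumr; apply: ler_sum => z _.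
  rewrite mulrCA ler_wpM2l//; first by rewrite -expr2 sqr_ge0.
  by apply: pmu; apply: open_measurable_config; exact: ch.
apply/eqP; rewrite -subr_eq0 -sqrf_eq0; apply: contraT => del.
have del0 : 0 < p * (v - a) ^+ 2 by rewrite mulr_gt0// lt_neqAle eq_sym del sqr_ge0.
(* Large enough to contradict the bound p * N ^ 2 * (v - a) ^ 2 <= N obtained from the second
   moments. *)
pose N := (Num.truncn (p * (v - a) ^+ 2)^-1).+1.
have N1 : 1 < N%:R * (p * (v - a) ^+ 2).
  by rewrite -ltr_pdivrMr// mul1r truncnS_gt.
have N0 : 0 < N%:R :> R by rewrite ltr0n.
have := le_trans (ler_wpM2l (ltW p0) (muSS N)) (le_trans (dom N) (nuSS N)).
rewrite exprMn; move: N1 N0; set n := N%:R => N1 N0 h; exfalso.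
have : n * (n * (p * (v - a) ^+ 2)) <= n * 1 by move: h; rewrite mulr1; congr (_ <= _); ring.
by rewrite ler_pM2l// leNgt N1.
Qed.

End ergodicity.

(** * Extreme points *)

Section conditioning.
Context {R : realType} {d : nat} (i0 : 'I_d).
Implicit Types (A : {fset site d}) (mu : probability (bconfig d) R).

(* The law of [eta \o avoid0] when [eta] has law [mu] conditioned on [D]. *)
Definition conditional_law mu (D : set (bconfig d)) (mD : measurable D) :=
  mnormalize (mrelabel (avoid0 i0) (mrestr mu mD)) mu.

Lemma conditional_lawE mu (D : set (bconfig d)) (mD : measurable D) (E : set (bconfig d)) :
  measurable E -> 0 < prob mu D ->
  conditional_law mu mD E = (prob mu (relabel (avoid0 i0) @^-1` E `&` D) / prob mu D)%:E.
Proof.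
move=> mE D0; rewrite /conditional_law /mnormalize /=.
have -> : mrelabel (avoid0 i0) (mrestr mu mD) setT = (prob mu D)%:E.
  by rewrite /mrelabel /mrestr preimage_setT setTI probE.
rewrite orbF eqe gt_eqF//= /mrelabel /mrestr probE// .
by apply: measurableI => //; exact: measurable_relabel.
Qed.

(** With [D] the event that the origin is occupied, [mu] is the mixture with weights [c 1] and 1 -
    [c 1] of its conditional laws given [D] and its complement, seen through [avoid0]. Extremality
    equates them, and on an occupation event of [n] sites this reads c (n + 1) / c 1 = (c n - c (n +
    1)) / (1 - c 1). *)
Lemma exchangeable_extreme_step mu (K : set (probability (bconfig d) R)) c :
  (forall nu, exchangeable nu -> K nu) -> extreme_points K mu ->
  (forall A, prob mu (occupied A) = c #|` A|) ->
  forall A, c #|` A|.+1 = c 1%N * c #|` A|.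
Proof.
move=> exK [_ ext] muc A.
have inj := avoid0_inj (i0 := i0).
pose D : set (bconfig d) := occupied [fset 0%R]%fset.
have mo B : measurable (occupied B : set (bconfig d)).
  by apply: open_measurable_config; exact: open_occupied.
have mD : measurable D := mo _.
have mCD : measurable (~` D) by exact: measurableC.
have D1 : prob mu D = c 1%N by rewrite muc cardfs1.
have splitD E : measurable (E : set (bconfig d)) ->
    prob mu E = prob mu (E `&` D) + prob mu (E `&` ~` D).
  move=> mE; apply: EFin_inj; rewrite EFinD -!probE//; [|exact: measurableI..].
  rewrite -measureU//; [|exact: measurableI..|].
    by rewrite -setIUr setUCr setIT.
  by rewrite setIACA setICr setI0.
have CD1 : prob mu (~` D) = 1 - c 1%N.
  by have := splitD setT measurableT; rewrite !setTI prob_setT D1 => ->; rewrite addrC addKr.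
have preE B : relabel (avoid0 i0) @^-1` occupied B `&` D =
    occupied ((0%R |` [fset avoid0 i0 x | x in B])%fset).
  by rewrite relabel_occupied setIC -occupiedU.
have cS B : prob mu (relabel (avoid0 i0) @^-1` occupied B `&` D) = c #|` B|.+1.
  rewrite preE muc cardfsU1 card_imfset//.
  suff -> : 0 \notin [fset avoid0 i0 x | x in B]%fset by [].
  by apply/imfsetP => -[x _ /esym/eqP]; rewrite (negbTE (avoid0_neq0 i0 x)).
have cB B : prob mu (relabel (avoid0 i0) @^-1` occupied B) = c #|` B|.
  by rewrite relabel_occupied muc card_imfset.
have cCD B : prob mu (relabel (avoid0 i0) @^-1` occupied B `&` ~` D) = c #|` B| - c #|` B|.+1.
  have := splitD _ (measurable_relabel (avoid0 i0) (mo B)).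
  by rewrite cB cS => ->; rewrite addrC addKr.
have c1_ge0 : 0 <= c 1%N by rewrite -D1 prob_ge0.
have c1_le1 : 0 <= 1 - c 1%N by rewrite -CD1 prob_ge0.
have mP B : measurable (relabel (avoid0 i0) @^-1` occupied B : set (bconfig d)).
  by apply: measurable_relabel; exact: mo.
(* When [c 1] is 0 or 1, one of the two conditionings is on a null event; these cases follow from
   monotonicity of the probability. *)
move: c1_ge0; rewrite le_eqVlt => /predU1P[c10|c10].
  rewrite -c10 mul0r; apply/eqP; rewrite eq_le -{2}(cS A) prob_ge0 andbT c10 -D1 -(cS A).
  apply: prob_le => //; exact: measurableI.
move: c1_le1; rewrite le_eqVlt => /predU1P[c11|c11].
  have c1E : c 1%N = 1 by lra.
  rewrite c1E mul1r; apply/eqP; rewrite eq_sym -subr_eq0 -(cCD A) eq_le prob_ge0 andbT.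
  rewrite [X in _ <= X]c11 -CD1; apply: prob_le => //; exact: measurableI.
have D0 : 0 < prob mu D by rewrite D1.
have CD0 : 0 < prob mu (~` D) by rewrite CD1.
have ex : exchangeable mu by exists c.
have p01 : 0 < c 1%N < 1 by rewrite c10/=; lra.
have mix (E : set (bconfig d)) : measurable E ->
    mu E = ((c 1%N)%:E * conditional_law mu mD E + (1 - c 1%N)%:E * conditional_law mu mCD E)%E.
  move=> mE; rewrite !conditional_lawE// D1 CD1 -!EFinM -EFinD.
  rewrite mulrCA divff ?mulr1 ?gt_eqF// mulrCA divff ?mulr1 ?gt_eqF//.
  rewrite -splitD; last exact: measurable_relabel.
  by rewrite -(exchangeable_relabel inj ex mE) probE//; exact: measurable_relabel.
have := ext (conditional_law mu mD) (conditional_law mu mCD) (c 1%N) _ _ p01 mix (occupied A) (mo A).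
move=> /(_ _ _)/wrap[].
- apply: exK; exists (fun n => c n.+1 / c 1%N) => B.
  by rewrite -[LHS]/(fine (conditional_law mu mD (occupied B))) conditional_lawE// cS D1.
- apply: exK; exists (fun n => (c n - c n.+1) / (1 - c 1%N)) => B.
  by rewrite -[LHS]/(fine (conditional_law mu mCD (occupied B))) conditional_lawE// cCD CD1.
rewrite -[X in X = _]/(conditional_law mu mD (occupied A)).
rewrite -[X in _ = X]/(conditional_law mu mCD (occupied A)).
rewrite !conditional_lawE// cS cCD D1 CD1 => -[] /eqP.
have c1n : c 1%N != 0 by rewrite gt_eqF.
have c1n' : 1 - c 1%N != 0 by rewrite gt_eqF.
rewrite (eqr_div _ _ c1n c1n') => /eqP h.
have -> : c #|` A|.+1 = c #|` A|.+1 * (1 - c 1%N) + c #|` A|.+1 * c 1%N by ring.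
by rewrite h; ring.
Qed.

End conditioning.

Lemma exchangeable_extreme_homogeneous {R : realType} {d : nat}
    (mu : probability (bconfig d) R) (K : set (probability (bconfig d) R)) :
  (0 < d)%N -> (forall nu, exchangeable nu -> K nu) -> extreme_points K mu ->
  exchangeable mu -> exists rho : R, 0 <= rho <= 1 /\ homogeneous_product rho mu.
Proof.
move=> d0 exK ext [c muc].
have mo B : measurable (occupied B : set (bconfig d)).
  by apply: open_measurable_config; exact: open_occupied.
exists (c 1%N); split.
  by rewrite -(cardfs1 (0 : site d)) -muc prob_ge0 prob_le1.
move=> A; rewrite -[LHS]/(mu (occupied A)) probE// muc; congr EFin.
move: {2}#|` A| (erefl #|` A|) => n.
elim: n A => [|n IHn] A An.
  rewrite An expr0 -(cardfs0 (site d)) -muc -(prob_setT mu); congr prob.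
  by apply/seteqP; split => // eta _ x; rewrite in_fset0.
have /fset0Pn[x xA] : A != fset0 by rewrite -cardfs_gt0 An.
have A'n : #|` A `\ x|%fset = n by apply/eqP; rewrite -eqSS -An (cardfsD1 x A) xA.
rewrite An -A'n (exchangeable_extreme_step (Ordinal d0) exK ext muc).
by rewrite IHn// -exprS.
Qed.

(** * Product measures are extreme, stationary shift invariant measures are exchangeable *)

Lemma homogeneous_exchangeable {R : realType} {d : nat} (rho : R)
    (nu : probability (bconfig d) R) :
  homogeneous_product rho nu -> exchangeable nu.
Proof. by move=> nuh; exists (fun n => rho ^+ n) => A; exact: homogeneous_prob. Qed.

(** Each component of a mixture equal to [nu] is dominated by a multiple of [nu], so
    [dominated_homogeneous] gives both the same occupation probabilities. *)
Lemma homogeneous_extreme {R : realType} {d : nat} (rho : R)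
    (nu : probability (bconfig d) R) (K : set (probability (bconfig d) R)) :
  (0 < d)%N -> homogeneous_product rho nu -> K nu -> K `<=` @shift_invariant R d ->
  extreme_points K nu.
Proof.
move=> d0 nuh Knu Ks; split => // mu1 mu2 p K1 K2 /andP[p0 p1] mix.
have mo B : measurable (occupied B : set (bconfig d)).
  by apply: open_measurable_config; exact: open_occupied.
have mixp (E : set (bconfig d)) : measurable E ->
    prob nu E = p * prob mu1 E + (1 - p) * prob mu2 E.
  by move=> mE; apply: EFin_inj; rewrite EFinD !EFinM -!probE// mix.
have p1' : 0 < 1 - p by rewrite subr_gt0.
have m12 A : mu1 (occupied A) = mu2 (occupied A).
  rewrite !probE//; congr EFin.
  rewrite (dominated_homogeneous A d0 nuh (Ks _ K1) p0); last first.
    by move=> E mE; rewrite mixp// lerDl mulr_ge0 ?prob_ge0// ltW.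
  rewrite (dominated_homogeneous A d0 nuh (Ks _ K2) p1')//.
  by move=> E mE; rewrite mixp// lerDr mulr_ge0 ?prob_ge0// ltW.
apply: (occupied_measure_unique _ m12).
by rewrite ltey_eq fin_num_measure.
Qed.

Lemma stationary_exchangeable {R : realType} {d : nat} (q : finperm d -> R)
    (T : R -> (config d -> R) -> config d -> R) (mu : probability (bconfig d) R) :
  (forall s, 0 <= q s) -> shift_invariant_rates q -> bounded_total_rates q ->
  irreducible_rates q -> bounded_range q -> range_closed q ->
  permutation_semigroup q T -> stationary T mu -> shift_invariant mu ->
  exchangeable mu.
Proof.
move=> q0 qs qb qi qr qc TP muT mus.
have bal := stationary_balance TP muT.
pose g A := prob mu (occupied A).
have gcard : forall A B, #|` A| = #|` B| -> g A = g B.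
  apply: (active_invariant_card qi qc) => s A sa.
  exact: (active_occupied q0 qb qs bal mus A qr sa).
(* The coefficient at [n] is read off an arbitrary set of [n] sites; at the cardinality of [A] the
   choice succeeds because [A] is a candidate. *)
exists (fun n => g (xget fset0 [set A : {fset site d} | #|` A| = n])) => A.
apply: gcard; apply/esym.
by apply: (xgetPex fset0 (P := [set B : {fset site d} | #|` B| = #|` A|])); exists A.
Qed.

Unset Implicit Arguments.

Theorem theorem3 (R : realType) (d : nat) (q : finperm d -> R)
    (T : R -> (config d -> R) -> config d -> R) :
  (0 < d)%N ->
  (forall s, 0 <= q s) ->
  shift_invariant_rates q ->
  bounded_total_rates q ->
  irreducible_rates q ->
  bounded_range q ->
  range_closed q -> bounded_ratios q ->
  permutation_semigroup q T ->
  extreme_points (stationary T `&` @shift_invariant R d)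
  = [set nu : probability (bconfig d) R |
      exists rho : R, 0 <= rho <= 1 /\ homogeneous_product rho nu].
Proof.
move=> d0 q0 qs qb qi qr qc _ TP.
have exK nu : exchangeable nu -> (stationary T `&` @shift_invariant R d) nu.
  by move=> ex; split; [exact: exchangeable_stationary q0 qb TP ex|exact: exchangeable_shift].
apply/seteqP; split => [mu ext|nu [rho [_ nuh]]].
  have [[muT mus] _] := ext.
  apply: (exchangeable_extreme_homogeneous d0 exK ext).
  exact: stationary_exchangeable q0 qs qb qi qr qc TP muT mus.
apply: (homogeneous_extreme d0 nuh); last by move=> mu [].
exact/exK/(homogeneous_exchangeable nuh).
Qed.
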